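(* There is an algorithm that solves the FIFO Stack-Up problem for every instance $I$ in time $O(|I|\cdot (m^4+2m^2+1)^{O(m^4)})$.
   Context: FIFO Stack-Up problem. An instance $I$ consists of a list $Q=(q_1,\ldots,q_k)$ of sequences of pairwise distinct bins, a pallet symbol ${\it plt}(b)$ (a positive integer) for every bin $b$, and a positive integer $p$; numbers are encoded in binary and $|I|$ denotes the instance size. Standing assumption: every pallet symbol that occurs is carried by at least two bins. $m$ is the number of distinct pallet symbols (pallets). A configuration is a tuple $(i_1,\ldots,i_k)$ with $0\le i_j\le |q_j|$, meaning that the first $i_j$ bins of $q_j$ have been removed. A pallet $t$ is open in configuration $(i_1,\ldots,i_k)$ if there are indices $j,\ell$ such that some bin for $t$ is at a position $\le i_j$ in $q_j$ and some bin for $t$ is at a position $> i_\ell$ in $q_\ell$. A transformation step removes the bin at position $i_j+1$ of some sequence $q_j$ (with $i_j<|q_j|$). A processing of $Q$ is a sequence of transformation steps from $(0,\ldots,0)$ to $(|q_1|,\ldots,|q_k|)$. The question is whether there is a processing of $Q$ such that in each configuration during the processing at most $p$ pallets are open. *)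

(* Defs.v *)
From mathcomp Require Import all_boot.

Set Implicit Arguments.
Unset Strict Implicit.
Unset Printing Implicit Defensive.

Record instance := Instance {
  bin : eqType;
  Q : seq (seq bin);
  plt : bin -> nat;
  p : nat;
  bins_distinct : uniq (flatten Q);
  plt_gt0 : forall b, b \in flatten Q -> 0 < plt b;
  p_gt0 : 0 < p;
  two_bins : forall b, b \in flatten Q ->
    2 <= count (fun b' => plt b' == plt b) (flatten Q)
}.

Definition pallets (I : instance) : seq nat :=
  undup (map (@plt I) (flatten (Q I))).

Definition num_pallets (I : instance) : nat := size (pallets I).

Definition nb_seqs (I : instance) : nat := size (Q I).

Definition bins_of (I : instance) (j : 'I_(nb_seqs I)) : seq (bin I) :=
  nth [::] (Q I) j.

(* [c j] is the number of bins already removed from the [j]-th sequence.  The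
   bound [c j <= size (bins_of j)] is not part of the type: it holds initially
   and [transformation] preserves it. *)
Definition configuration (I : instance) := {ffun 'I_(nb_seqs I) -> nat}.

Definition initial (I : instance) : configuration I := [ffun=> 0].

Definition final (I : instance) : configuration I :=
  [ffun j => size (bins_of j)].

Definition is_open (I : instance) (c : configuration I) (t : nat) : bool :=
  [exists j : 'I_(nb_seqs I),
     has (fun b => plt b == t) (take (c j) (bins_of j))] &&
  [exists l : 'I_(nb_seqs I),
     has (fun b => plt b == t) (drop (c l) (bins_of l))].

Definition num_open (I : instance) (c : configuration I) : nat :=
  count (is_open c) (pallets I).

Definition transformation (I : instance) : rel (configuration I) :=
  fun c c' => [exists j : 'I_(nb_seqs I),
    (c j < size (bins_of j)) && (c' == [ffun i => c i + (i == j)])].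

(* [s] lists the configurations visited after the initial one. *)
Definition processing (I : instance) (s : seq (configuration I)) : Prop :=
  path (@transformation I) (initial I) s /\ last (initial I) s = final I.

Definition fifo_stack_up (I : instance) : Prop :=
  exists s : seq (configuration I), processing s /\
    (forall c, c \in initial I :: s -> num_open c <= p I).

Definition bit_length (n : nat) : nat := (trunc_log 2 n).+1.

(* Least significant bit first, no leading zeros (for [0 < n]). *)
Definition bits (n : nat) : seq nat :=
  [seq (n %/ 2 ^ i) %% 2 | i <- iota 0 (bit_length n)].

(* A word over {0,1,2,3}: [2] ends a bin, [3] ends [p] and ends a sequence.  A
   bin is written as its pallet symbol; which bin it is, is its position. *)
Definition encode (I : instance) : seq nat :=
  bits (p I) ++ 3 ::
  flatten [seq flatten [seq bits (plt b) ++ [:: 2] | b <- q] ++ [:: 3]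
          | q <- Q I].

Definition inst_size (I : instance) : nat := size (encode I).

(* A word RAM with unit-cost instructions on [w]-bit words: besides the memory it
   has finitely many registers, namely those occurring in the program (a finite
   list of instructions); in [instr], [l] is a position in the program and the
   other arguments are register names, except for the literal [n]. *)
Inductive instr :=
  | Const (x n : nat)
  | Add (x y z : nat)
  | Sub (x y z : nat)
  | Read (x y : nat)
  | Write (x y : nat)
  | Jump (l : nat)
  | JumpZ (x l : nat).

Definition program := seq instr.

Record state := State { pc : nat; reg : nat -> nat; mem : nat -> nat }.

Definition upd (f : nat -> nat) (x v : nat) : nat -> nat :=
  fun y => if y == x then v else f y.

Definition exec_instr (w : nat) (i : instr) (s : state) : state :=
  let: State k r h := s in
  match i with
  | Const x n => State k.+1 (upd r x (n %% 2 ^ w)) h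
  | Add x y z => State k.+1 (upd r x ((r y + r z) %% 2 ^ w)) h
  | Sub x y z => State k.+1 (upd r x (r y - r z)) h
  | Read x y => State k.+1 (upd r x (h (r y))) h
  | Write x y => State k.+1 r (upd h (r x) (r y))
  | Jump l => State l r h
  | JumpZ x l => State (if r x == 0 then l else k.+1) r h
  end.

Definition halted (P : program) (s : state) : bool := size P <= pc s.

(* A halted machine stays as it is, so [halted] after [T] steps means that the
   program stops within [T] steps. *)
Definition step (w : nat) (P : program) (s : state) : state :=
  if onth P (pc s) is Some i then exec_instr w i s else s.

(* The input is in the memory cells 0, ..., |I| - 1, one symbol per cell, and
   its length is in register 0. *)
Definition start (input : seq nat) : state :=
  State 0 (upd (fun=> 0) 0 (size input)) (fun a => nth 0 input a).

Definition accepts (s : state) : bool := reg s 0 != 0.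

Definition solves_within (P : program) (w : nat) (I : instance) (T : nat) :
    Prop :=
  let s := iter T (step w P) (start (encode I)) in
  halted P s /\ (accepts s <-> fifo_stack_up I).

(* The words have Theta(log |I|) bits; by [0 < c], [inst_size I] and the input
   symbols fit into a word. *)
Definition solves_fifo_stack_up_in_time (P : program)
    (time : instance -> nat) : Prop :=
  exists c : nat, 0 < c /\
    forall I : instance,
      solves_within P (c * bit_length (inst_size I)) I (time I).

(* Main.v *)
Require Import Defs.
From mathcomp Require Import all_boot.
From mathcomp Require Import zify.

Set Implicit Arguments.
Unset Strict Implicit.
Unset Printing Implicit Defensive.

(* The order in which a processing closes the pallets is all that matters.  If
   the pallets are closed in the order E, then closing the first i + 1 of them
   forces every bin that precedes one of their bins in its sequence to be removed;
   the pallets of these bins are open or already closed, so there are at most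
   p + i of them.  Conversely, if this bound holds for all i, then removing for
   i = 0, 1, ... just these bins never opens more than p pallets.  Hence it is
   enough to try all m^m sequences of m pallets, each of which is checked by m
   backward scans of the input, using O(|I|) cells of memory.  Pallet symbols need
   not fit into a word, so they are first replaced by indices, comparing bit
   strings; p is only needed up to |I|. *)

(** * Structured programs for the word RAM *)

(** The number of configurations is not bounded in terms of [m] alone, so a search among them is
    avoided; there are only [m ^ m] candidate orders, and the input length enters only through
    linear scans. The bound [p + i] holds because the [i] pallets closed before are disjoint from
    the open ones, and because a pallet is already open just before the step that closes it, so that
    this step opens no further pallet. The latter is where two bins per pallet are needed. For the
    machine, a program logic that counts steps is set up; overflow has to be excluded at every
    addition. All values stay below 8(n + 1)^2, which words of [4 * bit_length n] bits can hold. The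
    time obtained is O(n * m^m * (m + 1)). It lies below the claimed bound, as m^m * (m + 1) is at
    most B^(m + 1) for B = m^4 + 2m^2 + 1. *)

Inductive cmd :=
  | Blk (l : seq instr)
  | Seq (c1 c2 : cmd)
  | If (x : nat) (c1 c2 : cmd)
  | While (c0 : cmd) (x : nat) (c1 : cmd).

Fixpoint csize (c : cmd) : nat :=
  match c with
  | Blk l => size l
  | Seq c1 c2 => csize c1 + csize c2
  | If _ c1 c2 => (csize c1 + csize c2).+2
  | While c0 _ c1 => (csize c0 + csize c1).+2
  end.

(** Jump targets of the machine are absolute, so the code depends on the position [o] where it is
    placed. A loop computes its test with [c0] and is left when register [x] is 0. *)
Fixpoint compile (o : nat) (c : cmd) : program :=
  match c with
  | Blk l => l
  | Seq c1 c2 => compile o c1 ++ compile (o + csize c1) c2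
  | If x c1 c2 =>
      JumpZ x (o + csize c1).+2 :: compile o.+1 c1 ++
      Jump (o + csize c1 + csize c2).+2 :: compile (o + csize c1).+2 c2
  | While c0 x c1 =>
      compile o c0 ++ JumpZ x (o + csize c0 + csize c1).+2 ::
      compile (o + csize c0).+1 c1 ++ [:: Jump o]
  end.

Lemma size_compile c o : size (compile o c) = csize c.
Proof.
elim: c o => [l|c1 IH1 c2 IH2|x c1 IH1 c2 IH2|c0 IH0 x c1 IH1] o //=.
- by rewrite size_cat IH1 IH2.
- by rewrite size_cat /= IH1 IH2 addnS.
- by rewrite size_cat /= size_cat /= IH0 IH1 addn1 !addnS.
Qed.

Definition instr_writes (i : instr) : seq nat :=
  match i with
  | Const x _ | Add x _ _ | Defs.Sub x _ _ | Read x _ => [:: x]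
  | _ => [::]
  end.

Fixpoint writes (c : cmd) : seq nat :=
  match c with
  | Blk l => flatten (map instr_writes l)
  | Seq c1 c2 | If _ c1 c2 | While c1 _ c2 => writes c1 ++ writes c2
  end.

(** Quantifying over the surrounding program makes runs compose. The second half is the frame
    property, read off the program text. *)
Definition run w c r h t r' h' :=
  (forall P1 P2, iter t (step w (P1 ++ compile (size P1) c ++ P2))
     (State (size P1) r h) = State (size P1 + csize c) r' h') /\
  (forall x, x \notin writes c -> r' x = r x).

Definition wp w c (Q : nat -> (nat -> nat) -> (nat -> nat) -> Prop) r h :=
  exists t r' h', run w c r h t r' h' /\ Q t r' h'.

Lemma onth_cat_size (P1 P2 : program) i : onth (P1 ++ i :: P2) (size P1) = Some i.
Proof. by elim: P1. Qed.

Lemma step_at w P1 i P2 r h :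
  step w (P1 ++ i :: P2) (State (size P1) r h) =
  exec_instr w i (State (size P1) r h).
Proof. by rewrite /step /= onth_cat_size. Qed.

Section Rules.
Variable w : nat.
Implicit Types (r h : nat -> nat) (Q : nat -> (nat -> nat) -> (nat -> nat) -> Prop).

Lemma wp_frame c Q r h :
  wp w c Q r h ->
  wp w c (fun t r' h' => Q t r' h' /\ forall x, x \notin writes c -> r' x = r x) r h.
Proof.
by move=> [t [r' [h' [H HQ]]]]; exists t, r', h'; split=> //; split=> //; case: H.
Qed.

Lemma wp_weaken c Q Q' r h :
  wp w c Q r h ->
  (forall t r' h', Q t r' h' -> (forall x, x \notin writes c -> r' x = r x) ->
     Q' t r' h') ->
  wp w c Q' r h.
Proof.
move=> /wp_frame [t [r' [h' [H [HQ F]]]]] HH; exists t, r', h'; split=> //.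
exact: HH.
Qed.

Lemma wp_nil Q r h : Q 0 r h -> wp w (Blk [::]) Q r h.
Proof. by move=> H; exists 0, r, h; split=> //; split=> //= P1 P2; rewrite addn0. Qed.

Lemma wp_instr i l Q r h r1 h1 :
  (forall k, exec_instr w i (State k r h) = State k.+1 r1 h1) ->
  (forall x, x \notin instr_writes i -> r1 x = r x) ->
  wp w (Blk l) (fun t => Q t.+1) r1 h1 -> wp w (Blk (i :: l)) Q r h.
Proof.
move=> E F [t [r' [h' [[H F'] HQ]]]]; exists t.+1, r', h'; split=> //.
split=> [P1 P2|x /=].
  rewrite iterSr /= step_at E.
  by have := H (rcons P1 i) P2; rewrite /= cat_rcons size_rcons addnS addSn.
by rewrite mem_cat negb_or => /andP[x1 x2]; rewrite F' // F.
Qed.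

Lemma upd_frame r x v y : y \notin [:: x] -> upd r x v y = r y.
Proof. by rewrite /upd inE => /negPf ->. Qed.

(** The side condition removes the reduction modulo [2 ^ w]: here and in [wp_add], exact arithmetic
    is bought by a proof that nothing overflows. *)
Lemma wp_const x n l Q r h : n < 2 ^ w ->
  wp w (Blk l) (fun t => Q t.+1) (upd r x n) h ->
  wp w (Blk (Const x n :: l)) Q r h.
Proof.
move=> b H; apply: wp_instr H => [k|y /=]; last exact: upd_frame.
by rewrite /= modn_small.
Qed.

Lemma wp_add x y z l Q r h : r y + r z < 2 ^ w ->
  wp w (Blk l) (fun t => Q t.+1) (upd r x (r y + r z)) h ->
  wp w (Blk (Add x y z :: l)) Q r h.
Proof.
move=> b H; apply: wp_instr H => [k|u /=]; last exact: upd_frame.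
by rewrite /= modn_small.
Qed.

Lemma wp_sub x y z l Q r h :
  wp w (Blk l) (fun t => Q t.+1) (upd r x (r y - r z)) h ->
  wp w (Blk (Defs.Sub x y z :: l)) Q r h.
Proof. by move=> H; apply: wp_instr H => // u; apply: upd_frame. Qed.

Lemma wp_read x y l Q r h :
  wp w (Blk l) (fun t => Q t.+1) (upd r x (h (r y))) h ->
  wp w (Blk (Read x y :: l)) Q r h.
Proof. by move=> H; apply: wp_instr H => // u; apply: upd_frame. Qed.

Lemma wp_write x y l Q r h :
  wp w (Blk l) (fun t => Q t.+1) r (upd h (r x) (r y)) ->
  wp w (Blk (Write x y :: l)) Q r h.
Proof. by move=> H; apply: wp_instr H. Qed.

Lemma wp_seq c1 c2 Q r h :
  wp w c1 (fun t1 r1 h1 => wp w c2 (fun t2 => Q (t1 + t2)) r1 h1) r h ->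
  wp w (Seq c1 c2) Q r h.
Proof.
move=> [t1 [r1 [h1 [[H1 F1] [t2 [r2 [h2 [[H2 F2] HQ]]]]]]]].
exists (t1 + t2), r2, h2; split=> //; split=> [P1 P2|x /=].
  rewrite addnC iterD /= -catA H1 -(size_compile c1 (size P1)) -size_cat catA H2.
  by rewrite size_cat size_compile addnA.
by rewrite mem_cat negb_or => /andP[x1 x2]; rewrite F2 // F1.
Qed.

(** The first branch pays for the test and for the jump over the second branch, the second one only
    for the test. *)
Lemma wp_if x c1 c2 Q r h :
  (r x != 0 -> wp w c1 (fun t => Q t.+2) r h) ->
  (r x = 0 -> wp w c2 (fun t => Q t.+1) r h) ->
  wp w (If x c1 c2) Q r h.
Proof.
case: (eqVneq (r x) 0) => [e _ /(_ e)|e /(_ isT) + _].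
  move=> [t [r' [h' [[H F] HQ]]]]; exists t.+1, r', h'; split=> //.
  split=> [P1 P2|y]; last by rewrite mem_cat negb_or => /andP[_]; apply: F.
  rewrite iterSr /= step_at /= e eqxx.
  set i1 := JumpZ _ _; set i2 := Jump _.
  have := H (P1 ++ i1 :: compile (size P1).+1 c1 ++ [:: i2]) P2.
  rewrite !size_cat /= !size_cat size_compile /= addn1 !addnS -!catA /= -!catA /=.
  by rewrite addnA !addSn.
move=> [t [r' [h' [[H F] HQ]]]]; exists t.+2, r', h'; split=> //.
split=> [P1 P2|y]; last by rewrite mem_cat negb_or => /andP[+ _]; apply: F.
rewrite iterS -addn1 iterD /= step_at /= (negPf e).
set i1 := JumpZ _ _; set i2 := Jump _; set k2 := compile _ c2.
have := H (rcons P1 i1) (i2 :: k2 ++ P2).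
rewrite size_rcons cat_rcons -!catA /= => ->.
rewrite (_ : _.+1 + _ = size (P1 ++ i1 :: compile (size P1).+1 c1)); last first.
  by rewrite size_cat /= size_compile; lia.
have := step_at w (P1 ++ i1 :: compile (size P1).+1 c1) i2 (k2 ++ P2) r' h'.
by rewrite -!catA /= => ->; rewrite !addnS addnA.
Qed.

(* [n] is a time credit: every iteration has to be paid out of it, which makes
   termination automatic. *)
Lemma wp_while c0 x c1 (I : nat -> (nat -> nat) -> (nat -> nat) -> Prop)
    (Q : (nat -> nat) -> (nat -> nat) -> Prop) n r h :
  (forall n' r' h', I n' r' h' ->
     (forall y, y \notin writes (While c0 x c1) -> r' y = r y) ->
     wp w c0 (fun t1 r1 h1 =>
       (r1 x = 0 -> t1 < n' /\ Q r1 h1) /\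
       (r1 x != 0 -> wp w c1 (fun t2 r2 h2 =>
          exists n2, n2 + (t1 + t2).+2 <= n' /\ I n2 r2 h2) r1 h1)) r' h') ->
  I n r h ->
  wp w (While c0 x c1) (fun t r' h' => t <= n /\ Q r' h') r h.
Proof.
move=> step_ok In.
(* The frame hypothesis refers to the registers at loop entry while the induction varies the current
   ones, hence the copy [r0]. *)
have [r0 e0 Fr0]: exists2 r0, r0 = r &
    forall y, y \notin writes (While c0 x c1) -> r0 y = r y by exists r.
rewrite -{1}e0 in In; rewrite -{1}e0; move: h In Fr0; clear e0; move: r0.
elim/ltn_ind: n => n IH r0 h In Fr0.
have [t1 [r1 [h1 [[H1 F1] [Hz Hnz]]]]] := step_ok _ _ _ In Fr0.
case: (eqVneq (r1 x) 0) => e.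
  have [lt_n HQ] := Hz e.
  exists t1.+1, r1, h1; split=> //; split=> [P1 P2|y]; last first.
    by rewrite mem_cat negb_or => /andP[? _]; apply: F1.
  rewrite iterS /= -catA H1 -(size_compile c0 (size P1)) -size_cat catA step_at.
  by rewrite /= e eqxx !size_cat size_compile !addnS addnA.
have [t2 [r2 [h2 [[H2 F2] [n2 [le_n I2]]]]]] := Hnz e.
have lt_n : n2 < n by lia.
have F12 y : y \notin writes (While c0 x c1) -> r2 y = r0 y.
  by rewrite mem_cat negb_or => /andP[y0 y1]; rewrite F2 // F1.
have Fr2 y : y \notin writes (While c0 x c1) -> r2 y = r y.
  by move=> yn; rewrite F12 // Fr0.
have [t3 [r3 [h3 [[H3 F3] [le_t HQ]]]]] := IH _ lt_n _ _ I2 Fr2.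
exists (t3 + (t2 + t1).+2), r3, h3; split; last by split=> //; lia.
split=> [P1 P2|y yn]; last by rewrite F3 // F12.
set P := P1 ++ _; suff E : iter (t2 + t1).+2 (step w P) (State (size P1) r0 h) =
  State (size P1) r2 h2 by rewrite iterD E; apply: H3.
rewrite iterS -addnS -add1n iterD iterD.
rewrite [iter t1 _ _](_ : _ = State (size P1 + csize c0) r1 h1); last first.
  by rewrite /P /= -catA; apply: H1.
set i1 := JumpZ x (size P1 + csize c0 + csize c1).+2.
rewrite [iter 1 _ _](_ : _ = State (size P1 + csize c0).+1 r1 h1); last first.
  rewrite /= /P /= -catA -(size_compile c0 (size P1)) -size_cat catA step_at.
  by rewrite /= (negPf e).
set k0 := compile (size P1) c0.
have sz : size (P1 ++ rcons k0 i1) = (size P1 + csize c0).+1.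
  by rewrite size_cat size_rcons size_compile addnS.
have eP : P = (P1 ++ rcons k0 i1) ++ compile (size P1 + csize c0).+1 c1 ++
    Jump (size P1) :: P2.
  rewrite /P /= -!catA cat_rcons /= -!catA /k0 /i1.
  exact: erefl.
rewrite [iter t2 _ _](_ : _ = State ((size P1 + csize c0).+1 + csize c1) r2 h2);
  last first.
  by rewrite eP -sz; apply: H2.
have <- : size ((P1 ++ rcons k0 i1) ++ compile (size P1 + csize c0).+1 c1) =
  (size P1 + csize c0).+1 + csize c1 by rewrite size_cat sz size_compile.
by rewrite eP catA step_at.
Qed.

(** A halted machine idles, so every [T] above the running time yields the same state. *)
Lemma wp_accepts c r h T Q :
  wp w c Q r h ->
  (forall t r' h', Q t r' h' -> t <= T) ->
  exists t r' h', Q t r' h' /\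
   iter T (step w (compile 0 c)) (State 0 r h) = State (csize c) r' h'.
Proof.
move=> [t [r' [h' [[H _] HQ]]]] le_T; exists t, r', h'; split=> //.
have := H [::] [::]; rewrite cats0 /= add0n => E.
rewrite -(subnK (le_T _ _ _ HQ)) iterD E.
elim: (T - t) => //= k ->; rewrite /step /= onth_default //.
by rewrite size_compile.
Qed.

End Rules.

(** * Closing orders of the pallets *)

(** The position just behind the last entry of [w] in [S], that is, the length of the shortest
    prefix containing all of these entries. *)
Fixpoint cut (S : pred nat) (w : seq nat) : nat :=
  if w is x :: w' then if has S w then (cut S w').+1 else 0 else 0.

Lemma cut_size S w : cut S w <= size w.
Proof. by elim: w => //= x w IH; case: ifP. Qed.

Lemma has_drop_cut S w : ~~ has S (drop (cut S w) w).
Proof. by elim: w => //= x w IH; case: ifP => //= /negbT. Qed.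

Lemma cut_min S w k : ~~ has S (drop k w) -> cut S w <= k.
Proof.
elim: w k => //= x w IH [|k]; first by move=> /negPf /= ->.
by case: ifP => // _ /IH.
Qed.

Lemma cut_sub (S S' : pred nat) w :
  {in w, subpred S S'} -> cut S w <= cut S' w.
Proof.
move=> sub; apply/cut_min/hasPn => x xd; apply/negP => /(sub _ (mem_drop xd)) Sx.
by case/negP: (has_drop_cut S' w); apply/hasP; exists x.
Qed.

Lemma sub_take (T : eqType) (s : seq T) i k x :
  i <= k -> x \in take i s -> x \in take k s.
Proof. by move=> le_ik; rewrite -(subnKC le_ik) takeD mem_cat => ->. Qed.

Lemma sub_drop (T : eqType) (s : seq T) i k x :
  i <= k -> x \in drop k s -> x \in drop i s.
Proof. by move=> /subnK <-; rewrite -drop_drop; apply: mem_drop. Qed.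

Lemma count_disjoint (a b u : pred nat) (s : seq nat) :
  (forall x, a x -> b x -> False) -> {in s, forall x, a x || b x -> u x} ->
  count a s + count b s <= count u s.
Proof.
move=> dis; elim: s => //= x s IH sub.
have {}IH := IH (fun y ys => sub y (mem_behead (s := x :: s) ys)).
have := sub x (mem_head x s); have := dis x.
by case: (a x); case: (b x) => //=; case: (u x) => //=; lia.
Qed.

Lemma count_cover (a b u : pred nat) (s : seq nat) :
  {in s, forall x, u x -> a x || b x} ->
  count u s <= count a s + count b s.
Proof.
elim: s => //= x s IH sub.
have {}IH := IH (fun y ys => sub y (mem_behead (s := x :: s) ys)).
have := sub x (mem_head x s).
by case: (a x); case: (b x) => //=; case: (u x) => //=; lia.
Qed.

Section PalletOrder.
Variable I : instance.
Implicit Types (c d : configuration I) (S : pred nat) (t : nat).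

Definition symbols (j : 'I_(nb_seqs I)) : seq nat := map (@plt I) (bins_of j).

Definition removed c t := [exists j, t \in take (c j) (symbols j)].
Definition remaining c t := [exists j, t \in drop (c j) (symbols j)].

Lemma is_openE c t : is_open c t = removed c t && remaining c t.
Proof.
congr (_ && _); apply: eq_existsb => j; rewrite -?map_take -?map_drop;
  by rewrite -has_pred1 has_map; apply: eq_has => b.
Qed.

Lemma mem_pallets t : (t \in pallets I) = [exists j, t \in symbols j].
Proof.
rewrite mem_undup; apply/mapP/existsP => [[b /flattenP[q qQ bq] ->]|[j /mapP[b bj ->]]].
  have lt_q : index q (Q I) < nb_seqs I by rewrite index_mem.
  by exists (Ordinal lt_q); apply/map_f; rewrite /bins_of nth_index.
by exists b => //; apply/flattenP; exists (bins_of j) => //; apply: mem_nth.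
Qed.

Lemma symbols_pallets j t : t \in symbols j -> t \in pallets I.
Proof. by move=> tj; rewrite mem_pallets; apply/existsP; exists j. Qed.

(** The least configuration in which all pallets of [S] are closed. *)
Definition cut_conf S : configuration I := [ffun j => cut S (symbols j)].

(* Closing the pallets of [S] forces exactly these pallets to be opened. *)
Definition touched S t := removed (cut_conf S) t.

Lemma cut_conf_sub S S' j :
  {in pallets I, subpred S S'} -> cut_conf S j <= cut_conf S' j.
Proof.
by move=> sub; rewrite !ffunE; apply: cut_sub => x /symbols_pallets; apply: sub.
Qed.

Lemma removed_le c d t :
  (forall j, c j <= d j) -> removed c t -> removed d t.
Proof.
move=> le_cd /existsP[j tj]; apply/existsP; exists j.
exact: sub_take (le_cd j) tj.
Qed.

Lemma remaining_le c d t :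
  (forall j, c j <= d j) -> remaining d t -> remaining c t.
Proof.
move=> le_cd /existsP[j tj]; apply/existsP; exists j.
exact: sub_drop (le_cd j) tj.
Qed.

Lemma touched_sub S S' t :
  {in pallets I, subpred S S'} -> touched S t -> touched S' t.
Proof. by move=> sub; apply: removed_le => j; apply: cut_conf_sub. Qed.

Lemma remaining_cut_conf S t : S t -> ~~ remaining (cut_conf S) t.
Proof.
move=> St; apply/existsPn => j; rewrite ffunE; apply/negP => tj.
by have /hasPn/(_ _ tj) := has_drop_cut S (symbols j); rewrite St.
Qed.

Lemma touched_mem S t : S t -> t \in pallets I -> touched S t.
Proof.
move=> St; rewrite mem_pallets => /existsP[j tj]; apply/existsP; exists j.
move: tj; rewrite -{1}(cat_take_drop (cut_conf S j) (symbols j)) mem_cat.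
by case/orP=> // tj; case/existsP: (remaining_cut_conf St); exists j.
Qed.

(** Any removal that does not overshoot [d] makes progress, so induction on the number of bins still
    to be removed applies. *)
Lemma path_between c d :
  (forall j, c j <= d j) -> (forall j, d j <= size (bins_of j)) ->
  exists s, [/\ path (@transformation I) c s, last c s = d &
    forall c', c' \in s -> forall j, c j <= c' j <= d j].
Proof.
move=> le_cd le_d; have [n] := ubnP (\sum_j (d j - c j)).
elim: n c le_cd => // n IH c le_cd le_n.
case: (boolP [exists j, c j < d j]) => [/existsP[j lt_j]|/existsPn eq_cd].
  pose c1 : configuration I := [ffun i => c i + (i == j)].
  have le_c1 i : c i <= c1 i <= d i.
    by rewrite ffunE leq_addr; case: eqP => [->|_]; rewrite /= ?addn1 ?addn0.
  have [||s [ps ls bs]] := IH c1; first by move=> i; case/andP: (le_c1 i).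
    rewrite ltnS in le_n; apply: leq_trans le_n; rewrite (bigD1 j) //= [leqRHS](bigD1 j) //=.
    rewrite ffunE eqxx addn1 -addSn subnSK // leq_add2l; apply: leq_sum => i _.
    by apply: leq_sub2l; case/andP: (le_c1 i).
  exists (c1 :: s); split=> //=.
    by rewrite ps andbT; apply/existsP; exists j; rewrite (leq_trans lt_j) ?eqxx.
  move=> c'; rewrite inE => /orP[/eqP -> // | /bs b] i.
  case/andP: (b i) => b1 ->; rewrite andbT; apply: leq_trans b1.
  by case/andP: (le_c1 i).
exists [::]; split=> //=; apply/ffunP => j; apply/eqP.
by rewrite eqn_leq le_cd leqNgt eq_cd.
Qed.


Lemma final_remaining t : ~~ remaining (final I) t.
Proof.
apply/existsPn => j; rewrite ffunE drop_oversize //.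
by rewrite size_map.
Qed.

Lemma initial_num_open : num_open (initial I) = 0.
Proof.
apply/eqP; rewrite -leqn0 leqNgt -has_count; apply/hasPn => t _.
rewrite is_openE negb_and; apply/orP; left; apply/existsPn => j.
by rewrite ffunE take0.
Qed.

Lemma pallets_uniq : uniq (pallets I). Proof. exact: undup_uniq. Qed.

Definition good_order (E : seq nat) := [/\ uniq E, E =i pallets I &
  forall i, i < size E ->
    count (touched (mem (take i.+1 E))) (pallets I) <= p I + i].

(** Between the cuts for [i] and for [i.+1] closed pallets, the [i] closed pallets and the open ones
    are disjoint, and all of them are touched by the later cut. Hence at most [p + i - i] pallets
    are open. *)
Lemma fifo_of_good_order E : good_order E -> fifo_stack_up I.
Proof.
move=> [uE eE cE].
have pE : perm_eq (pallets I) E by rewrite uniq_perm ?pallets_uniq // => x; rewrite eE.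
have c_le S j : cut_conf S j <= size (bins_of j).
  by rewrite ffunE (leq_trans (cut_size _ _)) ?size_map.
suff H i : i <= size E -> exists s, [/\ path (@transformation I) (initial I) s,
    last (initial I) s = cut_conf (mem (take i E)) &
    forall c, c \in initial I :: s -> num_open c <= p I].
  have [s [ps ls os]] := H _ (leqnn _); exists s; split=> //; split=> //.
  (* The last cut is the final configuration: a bin behind it would belong to a pallet outside
     [E]. *)
  rewrite ls take_size; apply/ffunP => j; rewrite !ffunE.
  apply/eqP; rewrite eqn_leq -{1}(size_map (@plt I)) cut_size /= leqNgt.
  apply/negP => lt_j.
  have: drop (cut (mem E) (symbols j)) (symbols j) != [::].
    by rewrite -size_eq0 size_drop size_map subn_eq0 -ltnNge.
  case Ed: (drop _ _) => [|x s'] // _.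
  have xj : x \in symbols j.
    by apply: (@mem_drop (cut (mem E) (symbols j))); rewrite Ed mem_head.
  have /hasPn/(_ x) := has_drop_cut (mem E) (symbols j).
  rewrite Ed mem_head => /(_ isT)/negP; apply.
  by rewrite /= eE (symbols_pallets xj).
elim: i => [_|i IH lt_i].
  exists [::]; split=> //= [|c].
    apply/ffunP => j; rewrite !ffunE take0; apply/esym/eqP; rewrite -leqn0.
    by apply/cut_min/hasPn => x.
  by rewrite inE => /eqP ->; rewrite initial_num_open.
have [s [ps ls os]] := IH (ltnW lt_i).
have sub_i : {in pallets I, subpred (mem (take i E)) (mem (take i.+1 E))}.
  by move=> x _ /=; apply: sub_take.
have [||s' [ps' ls' os']] := @path_between (cut_conf (mem (take i E)))
    (cut_conf (mem (take i.+1 E))).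
- by move=> j; apply: cut_conf_sub.
- by move=> j; apply: c_le.
exists (s ++ s'); split=> [||c]; rewrite ?cat_path ?last_cat ?ps ?ls //.
rewrite -cat_cons mem_cat => /orP[/os //|/os' bc].
have cnt_i : count (mem (take i E)) (pallets I) = i.
  rewrite (permP pE) -{2}(cat_take_drop i E) count_cat -[RHS]addn0.
  have -> : count (mem (take i E)) (take i E) = i.
    rewrite -[RHS](size_takel (ltnW lt_i)); apply/eqP; rewrite -all_count.
    by apply/allP.
  congr (_ + _); apply/eqP; rewrite -leqn0 leqNgt -has_count -[has _ _]negbK.
  by apply/negPn; move: uE; rewrite -{1}(cat_take_drop i E) cat_uniq => /and3P[].
rewrite -(leq_add2r i); apply: leq_trans (cE i lt_i).
rewrite addnC -{1}cnt_i; apply: count_disjoint => [x xi|x xI].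
  rewrite is_openE => /andP[_ /(remaining_le (c := cut_conf (mem (take i E))))].
  have le_c j : cut_conf (mem (take i E)) j <= c j by case/andP: (bc j).
  by move=> /(_ le_c); apply/negP/remaining_cut_conf.
case/orP=> [xi|]; first by apply: touched_mem => //=; apply: sub_take xi.
rewrite is_openE => /andP[+ _]; apply: removed_le => j.
by case/andP: (bc j).
Qed.

(** If no bin of [t] had been removed in [c] and none remained in [d], then the single bin removed
    between them would be the only bin of [t], against [two_bins]. *)
Lemma transformation_closes c d t :
  transformation c d -> t \in pallets I -> remaining c t -> ~~ remaining d t ->
  removed c t.
Proof.
case/existsP=> j /andP[lt_j /eqP def_d] tI ct dt; apply: contraNT dt => /existsPn nc.
move: tI; rewrite mem_undup => /mapP[b bQ def_t]; have := two_bins bQ.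
rewrite -def_t count_flatten sumnE big_map (big_nth [::]) big_mkord.
apply: contraTT => /existsPn nd; rewrite -ltnNge ltnS (bigD1 j) //=.
(* All bins of [t] still lie behind [c] and none lies behind [d], so only sequence [j] can hold one,
   namely the bin just removed. *)
have cnt (i : 'I_(nb_seqs I)) : count (fun b' => plt b' == t) (nth [::] (Q I) i) <= (i == j).
  rewrite -[count _ _](count_map (@plt I) (pred1 t)).
  rewrite -[map _ _](cat_take_drop (c i)) count_cat.
  rewrite (count_memPn (nc i)) add0n; have := nd i; rewrite def_d ffunE.
  case: eqP => [->|_]; last by rewrite addn0 => /count_memPn ->.
  rewrite addn1 (@drop_nth _ 0 (c j)) ?size_map // => H /=.
  by rewrite (count_memPn H) addn0 leq_b1.
rewrite big1 => [|i ij]; first by rewrite addn0; have := cnt j; rewrite eqxx.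
by apply/eqP; rewrite -leqn0; have := cnt i; rewrite (negPf ij).
Qed.

Lemma transformation_le c d : transformation c d -> forall j, c j <= d j.
Proof. by case/existsP=> j /andP[_ /eqP ->] i; rewrite ffunE leq_addr. Qed.

(** The witness is the symbol of the removed bin, the only pallet whose status can change. *)
Lemma transformation_remaining c d : transformation c d ->
  exists t, forall x, (remaining c x -> remaining d x \/ x = t) /\
    (removed d x -> removed c x \/ x = t).
Proof.
case/existsP=> j /andP[lt_j /eqP ->]; exists (nth 0 (symbols j) (c j)) => x.
have lt_s : c j < size (symbols j) by rewrite size_map.
split=> /existsP[i]; rewrite ?ffunE; case: (eqVneq i j) => [->|ij]; rewrite /= ?addn0.
- rewrite (drop_nth 0) // inE => /orP[/eqP -> |xj]; [by right | left].
  by apply/existsP; exists j; rewrite ffunE eqxx addn1.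
- by move=> xi; left; apply/existsP; exists i; rewrite ffunE (negPf ij) addn0.
- rewrite addn1 (take_nth 0) // mem_rcons inE => /orP[/eqP -> |xj]; [by right | left].
  by apply/existsP; exists j.
- by move=> xi; left; apply/existsP; exists i.
Qed.

(** Minimality of the cut: every configuration in which [S] is closed lies above it. *)
Lemma touched_le (S : pred nat) d u :
  (forall x, S x -> ~~ remaining d x) -> touched S u -> removed d u.
Proof.
move=> Sd; apply: removed_le => j; rewrite ffunE; apply: cut_min.
apply/hasPn => x xj; apply/negP => /Sd /existsPn/(_ j).
by rewrite xj.
Qed.

(** [E] lists the pallets that are still to be closed from [c] on. Those closed before are counted
    separately, which makes the claim inductive along the path. *)
Lemma order_of_path c s :
  path (@transformation I) c s -> last c s = final I ->
  (forall d, d \in c :: s -> num_open d <= p I) ->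
  exists E, [/\ uniq E, forall t, (t \in E) = (t \in pallets I) && remaining c t &
    forall i, i < size E ->
      count (touched (fun x => ~~ remaining c x || (x \in take i.+1 E))) (pallets I)
      <= p I + count (fun x => ~~ remaining c x) (pallets I) + i].
Proof.
elim: s c => [c _ /= -> _|d s IH c /= /andP[cd ps] ls os].
  exists [::]; split=> // t; rewrite (negPf (final_remaining t)).
  by rewrite andbF.
have [d' d's|E [uE eE cE]] := IH d ps ls; first by apply: os; rewrite inE d's orbT.
have le_cd := transformation_le cd.
have rem_cd x : remaining d x -> remaining c x by apply: remaining_le.
have [t Ht] := transformation_remaining cd.
(* Either the step closes a pallet [t], which then heads the order, or the set of closed pallets is
   unchanged and so is the order. *)
have [/andP[/andP[tI tc] td]|same] :=
  boolP ((t \in pallets I) && remaining c t && ~~ remaining d t); last first.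
  have eq_cd : {in pallets I, forall x, remaining d x = remaining c x}.
    move=> x xI; apply/idP/idP; first exact: rem_cd.
    move=> xc; case: (Ht x) => /(_ xc) [] // ext _; move: same.
    by rewrite -ext xI xc /= negbK.
  exists E; split=> // [x|i lt_i].
    by rewrite eE; case: (boolP (x \in pallets I)) => //= /eq_cd.
  have <- : count (fun x => ~~ remaining d x) (pallets I) =
            count (fun x => ~~ remaining c x) (pallets I).
    by apply: eq_in_count => x /eq_cd ->.
  apply: leq_trans (cE i lt_i); apply: sub_count => x.
  by apply: touched_sub => y /eq_cd ->.
have dE x : remaining c x = remaining d x || (x == t).
  apply/idP/orP => [xc|[/rem_cd //|/eqP -> //]].
  by case: (Ht x) => /(_ xc) [->|->]; [left | right].
have tE : t \notin E by rewrite eE tI (negPf td).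
exists (t :: E); split=> [|x|[_|i lt_i]] /=.
- by rewrite tE.
- rewrite inE eE dE; case: eqP => [->|_]; first by rewrite tI orbT.
  by rewrite orbF.
(* A pallet touched here is removed in [d]. So it is already removed in [c], hence open or closed
   there, or it is [t], which is open in [c]. *)
- rewrite addn0 take0; have := os c (mem_head _ _).
  rewrite -(leq_add2r (count (fun x => ~~ remaining c x) (pallets I))).
  apply: leq_trans; apply: count_cover => x xI.
  move=> /(@touched_le _ d) H; rewrite is_openE.
  have /(proj2 (Ht x)) [] : removed d x.
  + apply: H => y; rewrite inE dE negb_or => /orP[/andP[] //|/eqP -> //].
  + by move=> ->; case: (remaining c x).
  by move=> ->; rewrite (transformation_closes cd tI tc td) tc.
apply: leq_trans (leq_trans (cE i lt_i) _).
  apply: sub_count => x; apply: touched_sub => y _.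
  by rewrite inE dE negb_or; case: eqP => [->|]; rewrite ?td //= andbT.
(* Compared with [d], one pallet fewer is closed in [c], but the index in [t :: E] is larger by
   one. *)
rewrite addnS -addSn -addnS leq_add2r leq_add2l.
apply: leq_trans (count_cover (a := fun x => ~~ remaining c x) (b := pred1 t) _) _.
  by move=> x _; rewrite dE negb_or => -> /=; case: eqP.
by rewrite count_uniq_mem ?pallets_uniq // tI addn1.
Qed.

Lemma fifo_stack_upP : fifo_stack_up I <-> exists E, good_order E.
Proof.
split=> [[s [[ps ls] os]]|[E]]; last exact: fifo_of_good_order.
have [E [uE eE cE]] := order_of_path ps ls os.
have rem0 t : t \in pallets I -> remaining (initial I) t.
  rewrite mem_pallets => /existsP[j tj]; apply/existsP; exists j.
  by rewrite ffunE drop0.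
exists E; split=> // [t|i lt_i].
  by rewrite eE; case: (boolP (t \in pallets I)) => //= /rem0.
have := cE i lt_i; rewrite [count (fun x => ~~ _) _](_ : _ = 0) ?addn0; last first.
  apply/eqP; rewrite -leqn0 leqNgt -has_count; apply/hasPn => x /rem0.
  by rewrite negbK.
apply: leq_trans; apply: sub_count => x; apply: touched_sub => y _ /= ->.
by rewrite orbT.
Qed.

End PalletOrder.

(** * The program *)

(* With n = |I|, cells 0 .. n-1 hold the input and there are five arrays of n cells:
   - at n: the bins as pallet indices plus one, with 0 for the end of a sequence;
   - at 2n: for every pallet index, the address of a bin of this pallet;
   - at 3n: the candidate order, an m-digit number in base m;
   - at 4n and 5n: the characteristic functions of the pallets closed so far and
     of the pallets that they force to be opened.
   Registers 0 to 5 hold n, 1, 2n, 3n, 4n, 5n; registers 12, 13, 30 hold 2, 3, 0;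
   registers 6, 7, 8, 9 hold p, m, the length of the array at n, and the position
   in the input.  Register 10 runs through the powers of 2, but stops growing when
   it exceeds n, so that p is only exact up to n and cannot overflow. *)
Definition nop := Blk [::].

Definition init_code := Blk [:: Const 1 1; Const 12 2; Const 13 3; Const 10 1;
  Add 2 0 0; Add 3 2 0; Add 4 3 0; Add 5 4 0].

Definition parse_code :=
  While (Blk [:: Read 14 9; Defs.Sub 15 13 14]) 15
    (Seq (If 14 (Blk [:: Add 6 6 10]) nop)
    (Seq (Blk [:: Defs.Sub 15 10 0])
    (Seq (If 15 nop (Blk [:: Add 10 10 10]))
         (Blk [:: Add 9 9 1])))).

(** For the symbols x and y read, register 20 becomes |x - y| and register 22 becomes 2 - y - 2|x -
    y|, truncated at 0. The latter is positive exactly when x = y is a bit, so one test covers both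
    a difference and the end of the strings. *)
Definition compare_code :=
  While (Blk [:: Read 18 16; Read 19 17; Defs.Sub 20 18 19; Defs.Sub 21 19 18;
              Add 20 20 21; Defs.Sub 22 12 19; Defs.Sub 22 22 20;
              Defs.Sub 22 22 20]) 22
    (Blk [:: Add 16 16 1; Add 17 17 1]).

(** Register 23 starts with the size of the table, the value of [index] for an absent symbol. There
    is no early exit, as at most one entry can match. *)
Definition lookup_code :=
  Seq (Blk [:: Add 23 7 30; Const 24 0])
  (While (Blk [:: Defs.Sub 25 7 24]) 25
    (Seq (Blk [:: Add 26 2 24; Read 16 26; Add 17 9 30])
    (Seq compare_code
    (Seq (If 20 nop (Blk [:: Add 23 24 30]))
         (Blk [:: Add 24 24 1]))))).

Definition skip_code :=
  While (Blk [:: Read 14 9; Defs.Sub 15 12 14]) 15 (Blk [:: Add 9 9 1]).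

Definition bin_code :=
  Seq lookup_code
  (Seq (Blk [:: Defs.Sub 25 7 23])
  (Seq (If 25 nop (Blk [:: Add 26 2 7; Write 26 9; Add 7 7 1]))
  (Seq skip_code (Blk [:: Add 23 23 1])))).

Definition tokens_code :=
  While (Blk [:: Defs.Sub 25 0 9]) 25
    (Seq (Blk [:: Read 14 9; Defs.Sub 15 13 14])
    (Seq (If 15 bin_code (Blk [:: Const 23 0]))
         (Blk [:: Add 26 0 8; Write 26 23; Add 8 8 1; Add 9 9 1]))).

Definition clear_code :=
  Seq (Blk [:: Const 24 0])
  (While (Blk [:: Defs.Sub 25 7 24]) 25
    (Blk [:: Add 26 4 24; Write 26 30; Add 26 5 24; Write 26 30; Add 24 24 1])).

(** Register 16 tells whether a closed pallet has been met in the current sequence, scanned from its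
    end; every bin seen while it is 1 has to be removed. Register 27 counts the marked pallets. *)
Definition scan_code :=
  Seq (Blk [:: Const 16 0; Add 17 8 30])
  (While nop 17
    (Seq (Blk [:: Defs.Sub 17 17 1; Add 26 0 17; Read 18 26])
    (If 18
      (Seq (Blk [:: Defs.Sub 18 18 1; Add 26 4 18; Read 19 26])
      (Seq (If 19 (Blk [:: Const 16 1]) nop)
      (If 16
        (Seq (Blk [:: Add 26 5 18; Read 19 26])
        (If 19 nop (Blk [:: Write 26 1; Add 27 27 1])))
        nop)))
      (Blk [:: Const 16 0])))).

Definition check_code :=
  Seq clear_code
  (Seq (Blk [:: Const 27 0; Const 28 1; Const 24 0])
  (While (Blk [:: Defs.Sub 25 7 24]) 25
    (Seq (Blk [:: Add 26 3 24; Read 18 26; Add 26 4 18; Read 19 26; Write 26 1])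
    (Seq (If 19 (Blk [:: Const 28 0]) nop)
    (Seq scan_code
    (Seq (Blk [:: Add 18 6 24; Defs.Sub 18 27 18])
    (Seq (If 18 (Blk [:: Const 28 0]) nop)
         (Blk [:: Add 24 24 1])))))))).

(** Adds 1 in base [m], least significant digit first. Register 19 is 0 exactly at a digit [m - 1],
    which becomes 0 with a carry; a carry out of the last digit ends the search. *)
Definition next_code :=
  Seq (Blk [:: Const 24 0])
  (Seq (While (Seq (Blk [:: Add 26 3 24; Read 18 26; Defs.Sub 19 7 18;
                         Defs.Sub 19 19 1; Defs.Sub 25 7 24])
              (If 19 (Blk [:: Const 25 0]) nop)) 25
         (Blk [:: Write 26 30; Add 24 24 1]))
  (Seq (Blk [:: Defs.Sub 25 7 24])
  (If 25 (Blk [:: Add 18 18 1; Write 26 18]) (Blk [:: Const 29 0])))).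

(* Register 29 is cleared to stop, register 31 is set on success. *)
Definition search_code :=
  Seq (Blk [:: Const 29 1])
  (While nop 29
    (Seq check_code
    (If 28 (Blk [:: Const 31 1; Const 29 0]) next_code))).

Definition main_code :=
  Seq init_code
  (Seq parse_code
  (Seq (Blk [:: Add 9 9 1])
  (Seq tokens_code
  (Seq search_code (Blk [:: Defs.Sub 0 31 30]))))).

Lemma updE f x v y : upd f x v y = if y == x then v else f y.
Proof. by []. Qed.

(** Symbolic execution of straight-line code; it stops at tests and loops and leaves the overflow
    conditions. *)
Ltac go :=
  lazymatch goal with
  | |- wp _ (Blk [::]) _ _ _ => apply: wp_nil; rewrite ?updE /=; go
  | |- wp _ nop _ _ _ => apply: wp_nil; rewrite ?updE /=; go
  | |- wp _ (Blk (Add _ _ _ :: _)) _ _ _ =>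
      apply: wp_add; rewrite ?updE /=; last go
  | |- wp _ (Blk (Const _ _ :: _)) _ _ _ =>
      apply: wp_const; rewrite ?updE /=; last go
  | |- wp _ (Blk (Defs.Sub _ _ _ :: _)) _ _ _ => apply: wp_sub; rewrite ?updE /=; go
  | |- wp _ (Blk (Read _ _ :: _)) _ _ _ => apply: wp_read; rewrite ?updE /=; go
  | |- wp _ (Blk (Write _ _ :: _)) _ _ _ => apply: wp_write; rewrite ?updE /=; go
  | |- wp _ (Seq _ _) _ _ _ => apply: wp_seq; go
  | |- _ => idtac
  end.

(** The value read and the current power of 2 matter only up to truncation by [minn _ n.+1].
    Truncation does not notice that the power stays fixed once it exceeds [n]. *)
Lemma min_add n a x b c q : b < 2 -> minn a n.+1 = minn x n.+1 ->
  minn c n.+1 = minn q n.+1 -> minn (a + b * c) n.+1 = minn (b * q + x) n.+1.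
Proof. by case: b => [|[|]] //; lia. Qed.

Lemma min_double n a q : a <= n -> minn a n.+1 = minn q n.+1 ->
  minn (a + a) n.+1 = minn (2 * q) n.+1.
Proof. lia. Qed.

Lemma min_large n a q : n < a -> minn a n.+1 = minn q n.+1 ->
  minn a n.+1 = minn (2 * q) n.+1.
Proof. lia. Qed.

(** * Parsing [p] and comparing bit strings *)

Section Specs.
Variables (w n : nat).
Hypothesis n_gt0 : 0 < n.
(** Addresses are at most [6 * n]; the quadratic room is for register 6, which can reach
    [2 * n * n]. *)
Hypothesis big : 8 * (n.+1 * n.+1) <= 2 ^ w.

Let big1 : 8 * n.+1 <= 2 ^ w. Proof. by apply: leq_trans big; lia. Qed.

Definition consts (r : nat -> nat) :=
  [/\ r 0 = n, r 1 = 1, r 2 = 2 * n, r 3 = 3 * n &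
   [/\ r 4 = 4 * n, r 5 = 5 * n, r 12 = 2, r 13 = 3 & r 30 = 0]].

Definition const_regs := [:: 0; 1; 2; 3; 4; 5; 12; 13; 30].

Lemma consts_frame (l : seq nat) (r r' : nat -> nat) :
  (forall x, x \notin l -> r' x = r x) ->
  all [pred x | x \notin l] const_regs -> consts r -> consts r'.
Proof.
move=> F /and5P[c0 c1 c2 c3 /and5P[c4 c5 c12 c13 /andP[c30 _]]].
by move=> [? ? ? ? [? ? ? ? ?]]; split; rewrite ?F.
Qed.

Lemma consts_upd r x v : x \notin const_regs -> consts r -> consts (upd r x v).
Proof.
move=> xc [? ? ? ? [? ? ? ? ?]]; do 2?split; rewrite updE; case: eqP => // e;
  by rewrite -e in xc.
Qed.

Lemma init_ok r h : r 0 = n -> r 30 = 0 ->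
  wp w init_code (fun t r' h' => [/\ t <= 8, consts r', h' = h & r' 10 = 1]) r h.
Proof.
move=> e0 e30; rewrite /init_code; go; rewrite ?e0; try lia.
by do 3?split; rewrite ?updE /= ?e0 ?e30 //; lia.
Qed.

(** [v %% 2 ^ i] is the number formed by the [i] lowest bits of [v]; this is the step to the next
    bit. *)
Lemma modn_expS v i : v %% 2 ^ i.+1 = (v %/ 2 ^ i) %% 2 * 2 ^ i + v %% 2 ^ i.
Proof.
have lt_b : v %% 2 ^ i < 2 ^ i by rewrite ltn_pmod // expn_gt0.
have lt_a := ltn_pmod (v %/ 2 ^ i) (isT : 0 < 2).
have -> : v %% 2 ^ i.+1 = (v %/ 2 ^ i %/ 2 * 2 ^ i.+1 +
    ((v %/ 2 ^ i) %% 2 * 2 ^ i + v %% 2 ^ i)) %% 2 ^ i.+1.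
  by rewrite addnA expnS mulnA -mulnDl -divn_eq -divn_eq.
rewrite modnMDl modn_small // expnS.
by move: ((v %/ 2 ^ i) %% 2) (v %% 2 ^ i) lt_a lt_b => a b; nia.
Qed.

Lemma size_bits v : v < 2 ^ size (bits v).
Proof. by rewrite size_map size_iota trunc_log_ltn. Qed.

Lemma nth_bits v i : i < size (bits v) -> nth 0 (bits v) i = (v %/ 2 ^ i) %% 2.
Proof.
by move=> lti; rewrite (nth_map 0) ?nth_iota //; move: lti; rewrite size_map size_iota.
Qed.

Lemma bits_eq u v : size (bits u) = size (bits v) ->
  (forall i, i < size (bits u) -> nth 0 (bits u) i = nth 0 (bits v) i) -> u = v.
Proof.
move=> sz eq_nth; rewrite -(modn_small (size_bits u)) -(modn_small (size_bits v)) -sz.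
elim: {-2}(size (bits u)) (leqnn (size (bits u))) => [|i IH] lti; first by rewrite !modn1.
by rewrite !modn_expS IH ?(ltnW lti) // -!nth_bits ?eq_nth -?sz.
Qed.

Definition token v := bits v ++ [:: 2].

Lemma size_token v : size (token v) = (size (bits v)).+1.
Proof. by rewrite size_cat addn1. Qed.

Lemma nth_token v i : i <= size (bits v) ->
  if i < size (bits v) then nth 0 (token v) i = nth 0 (bits v) i /\ nth 0 (token v) i < 2
  else nth 0 (token v) i = 2.
Proof.
move=> lei; rewrite /token nth_cat; case: ltnP => [lti|].
  by rewrite nth_bits // ltn_mod.
by move=> gei; have /eqP -> : i == size (bits v); [rewrite eqn_leq lei | rewrite subnn].
Qed.

Definition stored (h : nat -> nat) a (s : seq nat) :=
  forall i, i < size s -> h (a + i) = nth 0 s i.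

(** The invariant is that the first [e] bits agree. The time is bounded by the length of [v] alone,
    so looking up a token of the input costs its own length per pallet, however long the stored
    symbols are. *)
Lemma compare_ok r h a b u v :
  consts r -> r 16 = a -> r 17 = b -> stored h a (token u) -> stored h b (token v) ->
  a + size (bits u) < n -> b + size (bits v) < n ->
  wp w compare_code (fun t r' h' => t <= 12 * (size (bits v)).+1 /\
    (h' = h /\ (r' 20 == 0) = (u == v))) r h.
Proof.
move=> Cr r16 r17 ha hb lta ltb.
set Lu := size (bits u) in lta; set Lv := size (bits v) in ltb *.
apply: wp_weaken.
  apply: (wp_while (I := fun c r' h' => exists e, [/\ e <= Lu, e <= Lv,
     c = 12 * (Lv - e) + 9, h' = h & [/\ r' 16 = a + e, r' 17 = b + e &
     forall i, i < e -> nth 0 (bits u) i = nth 0 (bits v) i]]) (n := 12 * Lv + 9)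
     (Q := fun r' h' => (h' = h /\ (r' 20 == 0) = (u == v)))); last first.
    by exists 0; split; rewrite ?subn0 ?addn0.
  move=> c r' h' [e [leu lev -> -> [e16 e17 eq_e]]] F.
  have := consts_frame F isT Cr => -[e0 e1 _ _ [_ _ e12 _ _]].
  go; rewrite e16 e17 ha ?hb ?e12 ?size_token //.
    have := nth_token leu; have := nth_token lev; rewrite -/Lu -/Lv.
    move: (nth 0 (token u) e) (nth 0 (token v) e) => x y Hx Hy.
    by case: ifP Hx => _; case: ifP Hy => _; lia.
  have := nth_token leu; have := nth_token lev; rewrite -/Lu -/Lv.
  have uv : u = v -> nth 0 (token u) e = nth 0 (token v) e by move=> ->.
  move: (nth 0 (token u) e) (nth 0 (token v) e) uv => x y uv Hy Hx; split.
    move=> stop; split; first by lia.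
    split=> //; apply/eqP/eqP => [xy|/uv]; last by lia.
    (* Stopping without a difference means that both strings end here, so they have the same
       length. *)
    have [ex ey] : x = 2 /\ y = 2 by case: ifP Hx Hy => _; case: ifP => _; lia.
    move: Hx Hy; rewrite ex ey; case: ltnP => [_|geu _]; first by case.
    case: ltnP => [_|gev _]; first by case.
    apply: bits_eq; rewrite -/Lu -/Lv; first by lia.
    by move=> i lti; apply: eq_e; lia.
  move=> cont.
  have xy : x = y by lia.
  have y2 : y < 2 by lia.
  case: ltnP Hx => [ltu [Hx _]|]; last by lia.
  case: ltnP Hy => [ltv [Hy _]|]; last by lia.
  go; rewrite ?e16 ?e17 ?e1; try by lia.
  exists (12 * (Lv - e.+1) + 9); split; first by lia.
  exists e.+1; split; rewrite ?updE //= ?e1 ?e16 ?e17; split=> //; try by lia.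
  move=> i; rewrite ltnS leq_eqVlt => /orP[/eqP -> |/eq_e //].
  by rewrite -Hx -Hy.
by move=> t' r' h' [le_t H] _; split=> //; lia.
Qed.

(** Register 10 is doubled only while it is at most [n], so it never exceeds [2 * n]; fewer than [n]
    bits are read, which bounds register 6 by [2 * n * n]. *)
Lemma parse_ok v r h (rest : seq nat) :
  size (bits v ++ 3 :: rest) <= n ->
  (forall a, a < n -> h a = nth 0 (bits v ++ 3 :: rest) a) ->
  consts r -> r 6 = 0 -> r 9 = 0 -> r 10 = 1 ->
  wp w parse_code (fun t r' h' => t <= 16 * (size (bits v)).+1 /\
    [/\ h' = h, r' 9 = size (bits v), r' 6 <= 2 * n * n &
        minn (r' 6) n.+1 = minn v n.+1]) r h.
Proof.
move=> szn hin Cr r6 r9 r10.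
have vL : v %% 2 ^ size (bits v) = v.
  by rewrite modn_small // size_map size_iota trunc_log_ltn.
have ltL : size (bits v) < n by move: szn; rewrite size_cat /=; lia.
have nthb i : i < size (bits v) -> nth 0 (bits v) i = (v %/ 2 ^ i) %% 2.
  by move=> lti; rewrite (nth_map 0) ?nth_iota //; move: lti; rewrite size_map size_iota.
set L := size (bits v) in vL ltL nthb *.
apply: wp_weaken.
  apply: (wp_while (I := fun c r' h' => exists i, [/\ i <= L, c = 16 * (L - i) + 4,
     r' 9 = i, h' = h & [/\ r' 6 <= 2 * n * i, r' 10 <= 2 * n,
       minn (r' 6) n.+1 = minn (v %% 2 ^ i) n.+1 &
       minn (r' 10) n.+1 = minn (2 ^ i) n.+1]]) (n := 16 * L + 4)
     (Q := fun r' h' => [/\ h' = h, r' 9 = L, r' 6 <= 2 * n * n &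
        minn (r' 6) n.+1 = minn v n.+1])); last first.
    exists 0; split; rewrite ?subn0 ?r6 ?r9 ?r10 //.
    by rewrite expn0 modn1; split=> //; lia.
  move=> c r' h' [i [leL -> r9' -> [b6 b10 m6 m10]]] F.
  have := consts_frame F isT Cr => -[e0 e1 _ _ [_ _ _ e13 _]].
  go; rewrite r9' e13 hin; last by lia.
  rewrite nth_cat -/L; split.
    case: ltnP => [lti|geL]; first by rewrite nthb //; have := ltn_pmod (v %/ 2 ^ i) (isT : 0 < 2); lia.
    have iL : i = L by lia.
    move=> _; split; first by lia.
    rewrite iL vL in m6 *; split=> //.
    by apply: leq_trans b6 _; rewrite iL leq_mul2l (ltnW ltL) orbT.
  case: ltnP => [lti _|geL]; last by have -> : i = L; [lia | rewrite subnn].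
  rewrite nthb //; have := modn_expS v i.
  have : (v %/ 2 ^ i) %% 2 < 2 by rewrite ltn_mod.
  move: ((v %/ 2 ^ i) %% 2) => b lt_b vS.
  have pos : 0 < 2 ^ i by rewrite expn_gt0.
  have bnd : 2 * n * i + 2 * n <= 2 * n * n.
    by rewrite -mulnSr leq_mul2l (leq_trans lti (ltnW ltL)) orbT.
  have big' : 2 * n * n < 2 ^ w by apply: leq_trans big; clear; lia.
  have b6' : r' 6 + b * r' 10 <= 2 * n * i.+1.
    by rewrite mulnSr; apply: leq_add => //; move: lt_b b10; case: b vS => [|[|]] //; lia.
  have m6' : minn (r' 6 + b * r' 10) n.+1 = minn (v %% 2 ^ i.+1) n.+1.
    by rewrite vS; apply: min_add.
  go; apply: (wp_weaken (Q := fun t r2 h2 => [/\ t <= 3, h2 = h & r2 6 = r' 6 + b * r' 10])).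
    apply: wp_if; rewrite ?updE /= => eb; go; rewrite ?updE /=;
      first by clear -b6 b10 bnd big'; lia.
      by split=> //; case: b lt_b eb {vS b6' m6'} => [|[|]] //=; lia.
    by split=> //; rewrite eb; lia.
  move=> t2 r2 h2 [le_t2 -> e6] F2.
  have F2_9 : r2 9 = i by rewrite F2 // !updE.
  have F2_10 : r2 10 = r' 10 by rewrite F2 // !updE.
  have F2_1 : r2 1 = 1 by rewrite F2 // !updE.
  have F2_0 : r2 0 = n by rewrite F2 // !updE.
  go; apply: (wp_weaken (Q := fun t r3 h3 => [/\ t <= 3, h3 = h, r3 10 <= 2 * n &
     minn (r3 10) n.+1 = minn (2 ^ i.+1) n.+1])).
    rewrite expnS; apply: wp_if; rewrite ?updE /= F2_10 F2_0 => eb; go.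
    - by rewrite F2_10; split=> //; apply: min_large m10; clear -eb; lia.
    - by rewrite F2_10; clear -b10 big1; lia.
    - by rewrite F2_10; split=> //; [clear -eb | apply: min_double m10; clear -eb]; lia.
  move=> t3 r3 h3 [le_t3 -> b10' m10'] F3.
  have F3_9 : r3 9 = i by rewrite F3 // !updE.
  have F3_1 : r3 1 = 1 by rewrite F3 // !updE.
  have F3_6 : r3 6 = r' 6 + b * r' 10 by rewrite F3 // !updE.
  go; rewrite F3_9 F3_1; first by clear -lti ltL big1; lia.
  exists (16 * (L - i.+1) + 4); split; first by clear -lti le_t2 le_t3; lia.
  by exists i.+1; split; rewrite ?updE //= ?F3_6 ?F3_9 ?F3_1 ?addn1.
by move=> t' r' h' [le_t H] _; split=> //; lia.
Qed.

End Specs.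

(** * Normalizing the input *)

Section Specs2.
Variables (w n : nat).
Hypothesis n_gt0 : 0 < n.
Hypothesis big : 8 * (n.+1 * n.+1) <= 2 ^ w.

Let big1 : 8 * n.+1 <= 2 ^ w. Proof. by apply: leq_trans big; lia. Qed.

Definition dictionary (h : nat -> nat) (P : seq nat) :=
  forall k, k < size P ->
    h (2 * n + k) + size (bits (nth 0 P k)) < n /\
    stored h (h (2 * n + k)) (token (nth 0 P k)).

Lemma lookup_ok r h P v i :
  consts n r -> r 7 = size P -> r 9 = i -> uniq P -> size P <= n ->
  dictionary h P -> stored h i (token v) -> i + size (bits v) < n ->
  wp w lookup_code (fun t r' h' =>
    [/\ t <= size P * (12 * (size (bits v)).+1 + 12) + 5, h' = h & r' 23 = index v P])
    r h.
Proof.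
move=> Cr r7 r9 uP szP dP hv ltv; have [e0 e1 e2 _ [_ _ _ _ e30]] := Cr.
set K := 12 * (size (bits v)).+1 + 12.
rewrite /lookup_code; go; rewrite ?r7 ?e30 ?addn0; try by lia.
apply: wp_weaken.
  apply: (wp_while (I := fun c r' h' => exists k, [/\ k <= size P,
     c = (size P - k) * K + 2, r' 24 = k, h' = h &
     r' 23 = if index v P < k then index v P else size P]) (n := size P * K + 2)
     (Q := fun r' h' => h' = h /\ r' 23 = index v P)); last first.
    by exists 0; split; rewrite ?subn0 ?updE.
  move=> c r' h' [k [lek -> r24 -> r23]] F.
  have Cr' : consts n r'.
    by apply: (consts_frame F) => //; do 2!apply: consts_upd => //.
  have [e0' e1' e2' _ [_ _ _ _ e30']] := Cr'.
  have r7' : r' 7 = size P by rewrite F.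
  have r9' : r' 9 = i by rewrite F.
  go; rewrite r7' r24; split.
    move=> stop; split; first by nia.
    have ek : k = size P by lia.
    by split=> //; rewrite r23 ek; case: ltnP => // ?; have := index_size v P; lia.
  move=> cont; have ltk : k < size P by lia.
  have [lt_u hu] := dP k ltk.
  go; rewrite ?e2' ?r24 ?e30' ?r9' ?addn0; try by lia.
  apply: wp_weaken.
    apply: (compare_ok n_gt0 big _ _ _ hu hv lt_u ltv); rewrite ?updE //.
  move=> t1 r1 h1 [le_t1 [-> cmp]] F1.
  have r1_1 : r1 1 = 1 by rewrite F1 // !updE.
  have r1_24 : r1 24 = k by rewrite F1 // !updE.
  have r1_23 : r1 23 = r' 23 by rewrite F1 // !updE.
  have r1_30 : r1 30 = 0 by rewrite F1 // !updE.
  apply: wp_seq; apply: (wp_weaken (Q := fun t2 r2 h2 => [/\ t2 <= 3, h2 = h &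
    r2 23 = if index v P < k.+1 then index v P else size P])).
    have idx : (nth 0 P k == v) = (index v P == k).
      apply/eqP/eqP => [<-|ek]; first by rewrite index_uniq.
      by rewrite -ek nth_index // -index_mem ek.
    apply: wp_if; rewrite ?updE => e20; go; rewrite ?r1_24 ?r1_30; try by lia.
      split=> //; rewrite r1_23 r23 ltnS (leq_eqVlt (index v P)) -idx -cmp.
      by rewrite (negPf e20).
    split=> //; rewrite addn0 ltnS (leq_eqVlt (index v P)) -idx -cmp e20 /=.
    by apply/esym/eqP; rewrite -idx -cmp e20.
  move=> t2 r2 h2 [le_t2 -> r2_23] F2.
  have r2_1 : r2 1 = 1 by rewrite F2.
  have r2_24 : r2 24 = k by rewrite F2.
  go; rewrite ?r2_1 ?r2_24; first by lia.
  exists ((size P - k.+1) * K + 2); split; last by exists k.+1; split; rewrite ?updE ?r2_24 ?r2_1 ?addn1.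
  by rewrite -(subnSK ltk) mulSn /K; lia.
by move=> t r' h' [le_t [-> ->]] _; split=> //; move: (size P * K) le_t => X; lia.
Qed.

Lemma skip_ok r h v i : consts n r -> r 9 = i -> stored h i (token v) ->
  i + size (bits v) < n ->
  wp w skip_code (fun t r' h' =>
    [/\ t <= 5 * (size (bits v)).+1, h' = h & r' 9 = i + size (bits v)]) r h.
Proof.
move=> Cr r9 hv ltv; set L := size (bits v) in ltv *.
apply: wp_weaken.
  apply: (wp_while (I := fun c r' h' => exists e, [/\ e <= L, c = 5 * (L - e) + 3,
     r' 9 = i + e & h' = h]) (n := 5 * L + 3)
     (Q := fun r' h' => h' = h /\ r' 9 = i + L)); last first.
    by exists 0; split; rewrite ?subn0 ?addn0.
  move=> c r' h' [e [lee -> r9' ->]] F.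
  have [_ e1 _ _ [_ _ e12 _ _]] := consts_frame F isT Cr.
  go; rewrite r9' e12 hv ?size_token //; have := nth_token lee; rewrite -/L.
  move: (nth 0 (token v) e) => x Hx; split.
    by case: ltnP Hx => [? [_ ?]|? _ _]; [lia | split; [lia | split=> //; lia]].
  case: ltnP Hx => [lte _ _|? ->]; last by [].
  go; rewrite ?r9' ?e1; first by lia.
  exists (5 * (L - e.+1) + 3); split; first by lia.
  by exists e.+1; split; rewrite ?updE /= ?r9' ?e1 ?addn1 ?addnS.
by move=> t r' h' [le_t [-> ->]] _; split=> //; lia.
Qed.

Definition add_pallet (P : seq nat) v := if v \in P then P else rcons P v.

Lemma bin_ok r h P v i :
  consts n r -> r 7 = size P -> r 9 = i -> uniq P -> size P < n ->
  dictionary h P -> stored h i (token v) ->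
  i + size (bits v) < n ->
  wp w bin_code (fun t r' h' =>
    [/\ t <= size P * (12 * (size (bits v)).+1 + 12) + 5 * (size (bits v)).+1 + 14,
       forall a, a < 2 * n \/ 3 * n <= a -> h' a = h a, r' 23 = (index v P).+1,
       r' 9 = i + size (bits v) &
       r' 7 = size (add_pallet P v) /\ dictionary h' (add_pallet P v)]) r h.
Proof.
move=> Cr r7 r9 uP szP dP hv ltv.
have [L eL] : exists L, L = size (bits v) by exists (size (bits v)).
rewrite -eL /bin_code; go.
have stored_lt h1 a u : (forall b, b < n -> h1 b = h b) -> a + size (bits u) < n ->
    stored h a (token u) -> stored h1 a (token u).
  move=> e lta ha j; rewrite size_token => ltj; rewrite e ?ha ?size_token //; lia.
apply: (wp_weaken (lookup_ok Cr r7 r9 uP (ltnW szP) dP hv ltv)).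
move=> t1 r1 h1 [le_t1 -> r1_23] F1.
have Cr1 := consts_frame F1 isT Cr; have [e0 e1 e2 _ _] := Cr1.
have r1_7 : r1 7 = size P by rewrite F1.
have r1_9 : r1 9 = i by rewrite F1.
go; rewrite ?r1_7 ?r1_23.
apply: (wp_weaken (Q := fun t2 r2 h2 => [/\ t2 <= 5,
    forall a, a < 2 * n \/ 3 * n <= a -> h2 a = h a,
    r2 7 = size (add_pallet P v) & dictionary h2 (add_pallet P v)])).
  rewrite /add_pallet -index_mem; apply: wp_if; rewrite !updE /= => e25; go;
    rewrite ?updE /= ?r1_7 ?e1 ?e2 ?r1_9; try by lia.
    by split=> //; rewrite ifT //; lia.
  have ge : (index v P < size P) = false by rewrite ltnNge -subn_eq0 e25.
  rewrite ge size_rcons addn1; split=> // [a|k].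
    by rewrite updE; case: eqP => //; lia.
  rewrite size_rcons ltnS => lek; rewrite updE nth_rcons.
  case: (ltnP k (size P)) => ltk.
    rewrite eqn_add2l ifN; last by rewrite neq_ltn ltk.
    have [lt_k sk] := dP _ ltk; split=> //; apply: stored_lt sk => // b ltb.
    by rewrite updE ifN //; apply/eqP; lia.
  have /eqP -> : k == size P by rewrite eqn_leq lek.
  rewrite !eqxx; split=> //; apply: stored_lt hv => // b ltb.
  by rewrite updE ifN //; apply/eqP; lia.
move=> t2 r2 h2 [le_t2 h2E r2_7 d2] F2.
have Cr2 : consts n r2 by apply: (consts_frame F2) => //; apply: consts_upd.
apply: wp_seq; apply: wp_weaken.
  apply: (@skip_ok _ _ v i Cr2) => //; first by rewrite F2 // updE.
  by apply: stored_lt hv => // b ltb; apply: h2E; lia.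
move=> t3 r3 h3 [le_t3 -> r3_9] F3.
have [_ e1' _ _ _] := consts_frame F3 isT Cr2.
have r3_23 : r3 23 = index v P by rewrite F3 // F2 // updE.
have r3_7 : r3 7 = size (add_pallet P v) by rewrite F3.
rewrite -eL in le_t1 le_t3 r3_9.
go; rewrite ?r3_23 ?e1'; first by have := index_size v P; lia.
split; rewrite ?updE //= ?addn1 //.
move: (size P * _) le_t1 => X le_t1; lia.
Qed.

End Specs2.

(** * Tokens of the input and the table of pallets *)

Definition enc (tok : option nat) : seq nat :=
  if tok is Some v then token v else [:: 3].

Definition add_token (P : seq nat) (tok : option nat) : seq nat :=
  if tok is Some v then add_pallet P v else P.

Definition symbol_table (toks : seq (option nat)) : seq nat :=
  foldl add_token [::] toks.

Definition code (P : seq nat) (tok : option nat) : nat :=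
  if tok is Some v then (index v P).+1 else 0.

Lemma symbol_table_rcons toks tok :
  symbol_table (rcons toks tok) = add_token (symbol_table toks) tok.
Proof. by rewrite /symbol_table -cats1 foldl_cat. Qed.

Lemma mem_symbol_table toks v : (v \in symbol_table toks) = (Some v \in toks).
Proof.
elim/last_ind: toks => // toks [u|] IH;
  rewrite symbol_table_rcons mem_rcons inE -IH //=.
rewrite /add_pallet (inj_eq Some_inj); case: ifP; last by rewrite mem_rcons inE.
by case: eqP => [->|].
Qed.

Lemma symbol_table_uniq toks : uniq (symbol_table toks).
Proof.
elim/last_ind: toks => // toks [u|] IH; rewrite symbol_table_rcons //=.
by rewrite /add_pallet; case: ifP => // un; rewrite rcons_uniq un.
Qed.

Lemma size_add_token P tok : size P <= size (add_token P tok) <= (size P).+1.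
Proof.
by case: tok => [v|] /=; rewrite /add_pallet ?leqnn ?leqnSn //; case: ifP; rewrite ?size_rcons leqnn ?leqnSn.
Qed.

Lemma size_symbol_table toks : size (symbol_table toks) <= size toks.
Proof.
elim/last_ind: toks => // toks tok IH; rewrite symbol_table_rcons size_rcons.
by have /andP[_ /leq_trans] := size_add_token (symbol_table toks) tok; apply.
Qed.

Lemma size_symbol_table_cat toks1 toks2 :
  size (symbol_table toks1) <= size (symbol_table (toks1 ++ toks2)).
Proof.
elim/last_ind: toks2 => [|s tok IH]; rewrite ?cats0 // -rcons_cat symbol_table_rcons.
by have /andP[/(leq_trans IH)] := size_add_token (symbol_table (toks1 ++ s)) tok.
Qed.

(** Indices already assigned survive the growth of the table, so the cells written earlier stay
    correct. *)
Lemma index_add_pallet P u v :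
  (u \in P) || (u == v) -> index u (add_pallet P v) = index u P.
Proof.
rewrite /add_pallet; case: ifP => // vP; rewrite -cats1 index_cat.
by case: ifP => //= uP /eqP ->; rewrite eqxx addn0 memNindex ?vP.
Qed.

Lemma size_flatten_enc toks : size toks <= size (flatten (map enc toks)).
Proof.
elim: toks => // tok toks IH; rewrite /= size_cat -add1n leq_add //.
by case: tok => // v; rewrite size_token.
Qed.

Section Specs3.
Variables (w n : nat).
Hypothesis n_gt0 : 0 < n.
Hypothesis big : 8 * (n.+1 * n.+1) <= 2 ^ w.

Let big1 : 8 * n.+1 <= 2 ^ w. Proof. by apply: leq_trans big; lia. Qed.

Lemma dictionary_ext h h' P :
  (forall a, a < n \/ 2 * n <= a -> h' a = h a) -> dictionary n h P -> dictionary n h' P.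
Proof.
move=> e d k ltk; have [lt_k sk] := d k ltk; rewrite e; last by right; lia.
by split=> // j ltj; rewrite e ?sk //; left; move: ltj; rewrite size_token; lia.
Qed.

(** A token of length l costs at most 12l + 12 <= 24l per known pallet, so a charge of [24 * m + 40]
    per input cell suffices. The cells from [3 * n] on remain 0 and later serve as the first
    candidate and as empty sets. *)
Lemma tokens_ok r h toks off :
  let inp := flatten (map enc toks) in
  let m := size (symbol_table toks) in
  consts n r -> r 7 = 0 -> r 8 = 0 -> r 9 = off -> 0 < off -> n = off + size inp ->
  (forall i, i < size inp -> h (off + i) = nth 0 inp i) ->
  (forall a, n <= a -> h a = 0) ->
  wp w tokens_code (fun t r' h' => t <= size inp * (24 * m + 40) + 2 /\
    [/\ r' 7 = m, r' 8 = size toks,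
        forall j, j < size toks -> h' (n + j) = code (symbol_table toks) (nth None toks j) &
        forall a, 3 * n <= a -> h' a = 0]) r h.
Proof.
move=> inp m Cr r7 r8 r9 off0 nE hin h0; set K := 24 * m + 40.
apply: (wp_while (I := fun c r' h' => exists s1 s2, [/\ toks = s1 ++ s2,
     c = size (flatten (map enc s2)) * K + 2, r' 9 = off + size (flatten (map enc s1)),
     r' 8 = size s1 & [/\ r' 7 = size (symbol_table s1), dictionary n h' (symbol_table s1),
     forall a, a < n -> h' a = h a, forall a, 3 * n <= a -> h' a = 0 &
     forall j, j < size s1 -> h' (n + j) = code (symbol_table s1) (nth None s1 j)]])
     (n := size inp * K + 2)); last first.
  exists [::], toks; split=> //=; first by rewrite addn0.
  by split=> // a lea; apply/h0/(leq_trans _ lea)/leq_pmull.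
move=> c r' h' [s1 [s2 [tE -> r9' r8' [r7' dP h'n h'0 h'c]]]] F.
have Cr' := consts_frame F isT Cr; have [e0 e1 e2 e3 [_ _ _ e13 e30]] := Cr'.
have szE : size inp = size (flatten (map enc s1)) + size (flatten (map enc s2)).
  by rewrite /inp tE map_cat flatten_cat size_cat.
go; rewrite r9' e0; split=> [stop|].
  have s2E : s2 = [::].
    have /eqP : size (flatten (map enc s2)) == 0.
      move: stop; rewrite nE szE; move: (size _) (size _) => x y; lia.
    by move=> sz0; apply/nilP; have := size_flatten_enc s2; rewrite sz0 leqn0.
  rewrite s2E cats0 in tE; rewrite s2E /m tE; split; first by [].
  by split.
case: s2 tE szE => [|tok s2] tE szE; first by rewrite /= in szE *; lia.
move=> _; set i := off + size (flatten (map enc s1)) in r9' *.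
have sz2 : size (flatten (map enc (tok :: s2))) = size (enc tok) + size (flatten (map enc s2)).
  by rewrite /= size_cat.
have lti : i + size (enc tok) <= n by rewrite /i; lia.
have stok : stored h' i (enc tok).
  move=> j ltj; rewrite h'n; last by apply: leq_trans lti; rewrite ltn_add2l.
  rewrite /i -addnA hin /inp; last by rewrite szE sz2 ltn_add2l (leq_trans ltj) ?leq_addr.
  rewrite tE map_cat flatten_cat nth_cat ifF; last by apply/negbTE; rewrite -leqNgt leq_addr.
  by rewrite addKn /= nth_cat ltj.
have sz_tok : 0 < size (enc tok) by case: (tok) => // v; rewrite size_token.
have lt_s1 : (size s1).+1 < n.
  by have := size_flatten_enc s1; lia.
have s1P := size_symbol_table s1.
have lt_tab : size (symbol_table s1) < n by exact: leq_ltn_trans s1P (ltnW lt_s1).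
have leP : size (symbol_table s1) <= m by rewrite /m tE size_symbol_table_cat.
go; rewrite r9' -[i]addn0 stok // addn0.
set P' := symbol_table (rcons s1 tok).
have P'E : P' = add_token (symbol_table s1) tok by rewrite /P' symbol_table_rcons.
apply: (wp_weaken (Q := fun t2 r2 h2 => [/\ t2 + 9 <= size (enc tok) * K,
    forall a, a < 2 * n \/ 3 * n <= a -> h2 a = h' a,
    r2 23 = code P' tok, (r2 9).+1 = i + size (enc tok) &
    r2 7 = size P' /\ dictionary n h2 P'])).
  rewrite P'E; apply: wp_if; rewrite !updE /= e13 => tst.
    case: tok stok sz_tok tst {tE szE sz2 P' P'E} lti => [v|] // stok _ tst lti.
    have eE : enc (Some v) = token v by [].
    rewrite eE in stok; rewrite eE size_token in lti *.
    rewrite addnS in lti.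
    apply: wp_weaken.
      apply: (bin_ok n_gt0 big _ _ _ (symbol_table_uniq s1) _ dP (v := v) (i := i)) => //;
        rewrite ?updE //.
    move=> t2 r2 h2 [le_t2 h2E r2_23 r2_9 [r2_7 d2]] F2.
    split=> //; last by rewrite r2_9 addnS.
      have : size (symbol_table s1) * (12 * (size (bits v)).+1 + 12) <=
             m * (24 * (size (bits v)).+1) by rewrite leq_mul //; lia.
      have -> : (size (bits v)).+1 * K = m * (24 * (size (bits v)).+1) + 40 * (size (bits v)).+1.
        by rewrite mulnDr [40 * _]mulnC mulnCA [_ * m]mulnC mulnCA.
      move: (m * _) (_ * (12 * _ + 12)) le_t2 => X Y; move: (size (bits v)) => L.
      clear; lia.
    by rewrite /code index_add_pallet // eqxx orbT.
  case: tok stok sz_tok tst {tE szE sz2 P' P'E} lti => [v|] // stok _ tst lti.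
    have : nth 0 (token v) 0 < 3.
      by have [_ /ltnW] := nth_token (leq0n (size (bits v))).
    by rewrite ltnNge -subn_eq0 (tst : 3 - nth 0 (token v) 0 = 0).
  go; first by lia.
  split=> //=; rewrite ?updE /= ?r9' ?mul1n ?addn1 //.
  by rewrite /K; move: (24 * m) => x; clear; lia.
move=> t2 r2 h2 [le_t2 h2E r2_23 r2_9 [r2_7 d2]] F2.
have Cr2 : consts n r2 by apply: (consts_frame F2) => //; do 3!apply: consts_upd => //.
have [f0 f1 _ _ _] := Cr2.
have r2_8 : r2 8 = size s1 by rewrite F2 // !updE.
go; rewrite ?f0 ?f1 ?r2_8; try by lia.
exists (size (flatten (map enc s2)) * K + 2); split.
  by rewrite /K in le_t2 *; rewrite size_cat mulnDl; lia.
exists (rcons s1 tok), s2; split; rewrite ?updE //= ?f1 ?r2_8.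
- by rewrite cat_rcons.
- by rewrite addn1 r2_9 /i map_rcons flatten_rcons size_cat addnA.
- by rewrite size_rcons addn1.
split=> //.
- by apply: dictionary_ext d2 => a lta; rewrite updE ifN //; apply/eqP; lia.
- by move=> a lta; rewrite updE ifN ?h2E ?h'n //; [left; lia | apply/eqP; lia].
- by move=> a lea; rewrite updE ifN ?h2E ?h'0 //; [right | apply/eqP; lia].
move=> j; rewrite size_rcons ltnS leq_eqVlt => /orP[/eqP ->|ltj].
  by rewrite updE eqxx r2_23 nth_rcons ltnn eqxx.
rewrite updE ifN; last by apply/eqP; lia.
rewrite h2E; last by left; lia.
rewrite nth_rcons ltj h'c // symbol_table_rcons.
case E: (nth None s1 j) => [u|] //=; case: (tok) => [v|] //=; rewrite index_add_pallet //.
by rewrite mem_symbol_table -E mem_nth.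
Qed.

End Specs3.

(** * Searching for a closing order *)

(** [W] is a suffix of the coded input, with [y.+1] for pallet [y] and 0 for the end of a sequence;
    only the rest of the current sequence is inspected. *)
Fixpoint flag (S : pred nat) (W : seq nat) : bool :=
  if W is y.+1 :: W' then S y || flag S W' else false.

(** The scan as a recursion from the right: a pallet is reached if one of its bins has a bin of [S]
    at or behind it in its sequence. [reachedE] identifies this with [touched]. *)
Fixpoint reached (S : pred nat) (W : seq nat) (u : nat) : bool :=
  if W is x :: W' then flag S W && (x == u.+1) || reached S W' u else false.

Lemma flag_sub (S S' : pred nat) W : subpred S S' -> flag S W -> flag S' W.
Proof.
by move=> sub; elim: W => // -[|y] W IH //= /orP[/sub -> //|/IH ->]; rewrite orbT.
Qed.

Lemma reached_sub (S S' : pred nat) W u :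
  subpred S S' -> reached S W u -> reached S' W u.
Proof.
move=> sub; elim: W => // x W IH /= /orP[/andP[f ->]|/IH ->]; last by rewrite orbT.
by have /= -> := flag_sub (W := x :: W) sub f.
Qed.

Lemma eq_reached (S S' : pred nat) W u : S =1 S' -> reached S W u = reached S' W u.
Proof. by move=> e; apply/idP/idP; apply: reached_sub => x; rewrite e. Qed.

Lemma reached0 W u : reached pred0 W u = false.
Proof.
have flag0 V : flag pred0 V = false by elim: V => // -[|y] V.
by elim: W => // -[|y] W IH; rewrite /= ?IH ?flag0.
Qed.

Lemma count_add_mem (T : pred nat) y (s : seq nat) :
  uniq s -> y \in s -> ~~ T y -> count (fun u => (u == y) || T u) s = (count T s).+1.
Proof.
move=> us ys Ty; have := count_predUI (pred1 y) T s.
rewrite (count_uniq_mem _ us) ys add1n => <-.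
rewrite -[LHS]addn0; congr (_ + _); apply/esym/eqP.
rewrite -leqn0 leqNgt -has_count; apply/hasPn => x _ /=.
by apply/negP => /andP[/eqP ->]; apply/negP.
Qed.

Fixpoint value m (D : seq nat) : nat := if D is d :: D' then d + m * value m D' else 0.

Lemma value_lt m D : all (ltn^~ m) D -> value m D < m ^ size D.
Proof.
elim: D => // d D IH /= /andP[ltd /IH]; rewrite expnS.
by move: (value m D) (m ^ size D) => x y; nia.
Qed.

(** Counting through the values therefore meets every list of [m] digits. *)
Lemma value_inj m D D' : all (ltn^~ m) D -> all (ltn^~ m) D' -> size D = size D' ->
  value m D = value m D' -> D = D'.
Proof.
elim: D D' => [|d D IH] [|d' D'] //= /andP[ltd aD] /andP[ltd' aD'] [sz] e.
have ed : d = d'.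
  have := congr1 (modn^~ m) e.
  by rewrite /= ![_ + m * _]addnC ![m * _]mulnC !modnMDl !modn_small.
move: e; rewrite ed => /addnI/eqP; rewrite eqn_pmul2l; last exact: leq_ltn_trans ltd.
by move=> /eqP eD; rewrite (IH D').
Qed.

Lemma value_nseq m k D : value m (nseq k 0 ++ D) = m ^ k * value m D.
Proof. by elim: k => [|k IH] /=; rewrite ?mul1n // IH expnS mulnA. Qed.

(** The conditions of [good_order] in terms of pallet indices, with distinctness tested digit by
    digit so that prefixes can be checked incrementally. *)
Definition valid W p m D k :=
  all (fun i => (nth 0 D i \notin take i D) &&
    (count (reached (mem (take i.+1 D)) W) (iota 0 m) <= p + i)) (iota 0 k).

Lemma validS W p m D k : valid W p m D k.+1 = valid W p m D k &&
  ((nth 0 D k \notin take k D) &&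
    (count (reached (mem (take k.+1 D)) W) (iota 0 m) <= p + k)).
Proof. by rewrite /valid -[k.+1]addn1 iotaD all_cat /= andbT add0n addn1. Qed.

(** * The arrays of the search and the backward scan *)

Section Specs4.
Variables (w n m : nat) (W : seq nat).
Hypothesis n_gt0 : 0 < n.
Hypothesis big : 8 * (n.+1 * n.+1) <= 2 ^ w.
Hypothesis le_mn : m <= n.
Hypothesis le_Wn : size W <= n.
Hypothesis W_lt : forall j y, j < size W -> nth 0 W j = y.+1 -> y < m.

Let big1 : 8 * n.+1 <= 2 ^ w. Proof. by apply: leq_trans big; lia. Qed.

Definition layout (h : nat -> nat) (D : seq nat) (S T : pred nat) :=
  [/\ forall j, j < size W -> h (n + j) = nth 0 W j,
      forall k, k < m -> h (3 * n + k) = nth 0 D k,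
      forall k, k < m -> h (4 * n + k) = S k &
      forall k, k < m -> h (5 * n + k) = T k].

Lemma layout_ext h D S T S' T' :
  layout h D S T -> (forall k, k < m -> S k = S' k) -> (forall k, k < m -> T k = T' k) ->
  layout h D S' T'.
Proof. by case=> hW hD hS hT eS eT; split=> // k ltk; rewrite -?eS -?eT // ?hS ?hT. Qed.

Lemma layout_set a v h D S T D' (S' T' : pred nat) : layout h D S T ->
  n + size W <= a ->
  (forall k, k < m -> if 3 * n + k == a then nth 0 D' k = v else nth 0 D' k = nth 0 D k) ->
  (forall k, k < m -> if 4 * n + k == a then S' k = v :> nat else S' k = S k) ->
  (forall k, k < m -> if 5 * n + k == a then T' k = v :> nat else T' k = T k) ->
  layout (upd h a v) D' S' T'.
Proof.
case=> hW hD hS hT lea eD eS eT; split=> k ltk; rewrite updE.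
- by rewrite ifN ?hW // neq_ltn (leq_trans _ lea) // ltn_add2l.
- by have := eD k ltk; case: eqP => // _ ->; rewrite hD.
- by have := eS k ltk; case: eqP => // _ ->; rewrite hS.
- by have := eT k ltk; case: eqP => // _ ->; rewrite hT.
Qed.

Lemma layout_setD h D S T D' k v : layout h D S T -> k < m ->
  (forall i, i < m -> nth 0 D' i = if i == k then v else nth 0 D i) ->
  layout (upd h (3 * n + k) v) D' S T.
Proof.
move=> L ltk eD; apply: (layout_set L) => [|i lti|i lti|i lti].
- by apply: leq_trans (leq_addr _ _); lia.
- by rewrite eD // eqn_add2l; case: eqP.
- by rewrite ifN //; apply/eqP; lia.
- by rewrite ifN //; apply/eqP; lia.
Qed.

Lemma layout_setS h D S T k (b : bool) : layout h D S T -> k < m ->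
  layout (upd h (4 * n + k) b) D (fun i => if i == k then b else S i) T.
Proof.
move=> L ltk; apply: (layout_set L) => [|i lti|i lti|i lti].
- by apply: leq_trans (leq_addr _ _); lia.
- by rewrite ifN //; apply/eqP; lia.
- by rewrite eqn_add2l; case: eqP.
- by rewrite ifN //; apply/eqP; lia.
Qed.

Lemma layout_setT h D S T k (b : bool) : layout h D S T -> k < m ->
  layout (upd h (5 * n + k) b) D S (fun i => if i == k then b else T i).
Proof.
move=> L ltk; apply: (layout_set L) => [|i lti|i lti|i lti].
- by apply: leq_trans (leq_addr _ _); lia.
- by rewrite ifN //; apply/eqP; lia.
- by rewrite ifN //; apply/eqP; lia.
- by rewrite eqn_add2l; case: eqP.
Qed.

Lemma clear_ok r h D S T : consts n r -> r 7 = m -> layout h D S T ->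
  wp w clear_code (fun t r' h' => t <= 8 * m + 4 /\ layout h' D pred0 pred0) r h.
Proof.
move=> Cr r7 L; rewrite /clear_code; go; first by lia.
apply: wp_weaken.
  apply: (wp_while (I := fun c r' h' => exists k, [/\ k <= m, c = 8 * (m - k) + 2,
     r' 24 = k & layout h' D (fun i => (k <= i) && S i) (fun i => (k <= i) && T i)])
     (n := 8 * m + 2) (Q := fun r' h' => layout h' D pred0 pred0)); last first.
    by exists 0; split; rewrite ?subn0 ?updE.
  move=> c r' h' [k [lek -> r24 L']] F.
  have Cr' : consts n r' by apply: (consts_frame F) => //; apply: consts_upd.
  have r7' : r' 7 = m by rewrite F // updE.
  have [e0 e1 e2 e3 [e4 e5 _ _ e30]] := Cr'.
  go; rewrite r7' r24; split.
    move=> stop; split; first by lia.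
    by apply: (layout_ext L') => i lti; rewrite leqNgt (leq_trans lti) //; lia.
  move=> cont; have ltk : k < m by lia.
  go; rewrite ?e4 ?e5 ?r24 ?e1 ?e30; try by lia.
  exists (8 * (m - k.+1) + 2); split; first by lia.
  exists k.+1; split; rewrite ?updE /= ?r24 ?e1 ?addn1 //.
  apply: (layout_ext (layout_setT false (layout_setS false L' ltk) ltk)) => i _ /=;
    by case: ltngtP => //= ->; rewrite eqxx.
by move=> t r' h' [le_t L'] _; split=> //; lia.
Qed.

(** The marks [T] are kept from earlier rounds: a reached pallet stays reached when [S] grows, so a
    scan only has to add and count new marks. *)
Lemma scan_ok r h D S T : consts n r -> r 8 = size W -> layout h D S T ->
  r 27 = count T (iota 0 m) ->
  wp w scan_code (fun t r' h' => t <= 25 * size W + 5 /\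
    exists T', [/\ T' =1 (fun u => T u || reached S W u), layout h' D S T' &
      r' 27 = count T' (iota 0 m)]) r h.
Proof.
move=> Cr r8 L r27; have [e0 e1 _ _ [_ _ _ _ e30]] := Cr.
rewrite /scan_code; go; rewrite ?r8 ?e30 ?addn0; try by lia.
apply: wp_weaken.
  apply: (wp_while (I := fun c r' h' => exists j T', [/\ j <= size W, c = 25 * j + 2,
     r' 17 = j, r' 16 = flag S (drop j W) &
     [/\ T' =1 (fun u => T u || reached S (drop j W) u), layout h' D S T' &
      r' 27 = count T' (iota 0 m)]])
     (n := 25 * size W + 2) (Q := fun r' h' => exists T',
        [/\ T' =1 (fun u => T u || reached S W u), layout h' D S T' &
      r' 27 = count T' (iota 0 m)])); last first.
    exists (size W), T; split; rewrite ?updE ?drop_size //.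
    by split=> // u; rewrite orbF.
  move=> c r' h' [j [T' [lej -> r17 r16 [T'E L' r27']]]] F.
  have Cr' : consts n r' by apply: (consts_frame F) => //; do 2!apply: consts_upd => //.
  have [f0 f1 _ _ [f4 f5 _ _ f30]] := Cr'.
  go; rewrite r17; split=> [j0|].
    by split; [lia | exists T'; split=> // u; rewrite T'E j0 drop0].
  case: j lej r17 r16 T'E => // j ltj r17 r16 T'E _.
  have [hW _ hS hT] := L'.
  go; rewrite ?f0 ?f1 ?r17 ?subSS ?subn0; try by lia.
  rewrite hW //; set x := nth 0 W j.
  have dropE : drop j W = x :: drop j.+1 W by rewrite (drop_nth 0).
  apply: (wp_weaken (Q := fun t2 r2 h2 => t2 <= 20 /\ exists T2,
     [/\ r2 16 = flag S (drop j W),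
      T2 =1 (fun u => T u || reached S (drop j W) u), layout h2 D S T2 &
      r2 27 = count T2 (iota 0 m)])); last first.
    move=> t2 r2 h2 [le_t2 [T2 [r2_16 T2E L2 r2_27]]] F2.
    exists (25 * j + 2); split; first by lia.
    exists j, T2; split=> //; first by apply: ltnW.
    by rewrite F2 // !updE.
  apply: wp_if; rewrite !updE /= => ex; last first.
    go; first by lia.
    split=> //; exists T'; split; rewrite ?updE ?dropE ?ex //.
  case Ex: x ex dropE => [|y] // _ dropE.
  have lty : y < m by apply: W_lt Ex.
  go; rewrite ?f0 ?f1 ?f4 ?subSS ?subn0; try by lia.
  rewrite hS //.
  have T'u u : (u == y) && flag S (drop j W) || T' u = T u || reached S (drop j W) u.
    by rewrite T'E dropE /= eqSS [y == u]eq_sym orbCA [_ && _]andbC.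
  apply: (wp_weaken (Q := fun t3 r3 h3 => [/\ t3 <= 3, h3 = h' & r3 16 = flag S (drop j W)])).
    apply: wp_if; rewrite !updE /= => eS; go; try by lia.
      by split=> //; rewrite dropE /=; case: (S y) eS.
    by split=> //; rewrite dropE /= r16; case: (S y) eS.
  move=> t3 r3 h3 [le_t3 -> r3_16] F3.
  have Cr3 : consts n r3.
    by apply: (consts_frame F3) => //; do 6!apply: consts_upd => //.
  have [g0 g1 _ _ [g4 g5 _ _ g30]] := Cr3.
  have r3_18 : r3 18 = y by rewrite F3 // !updE.
  have r3_27 : r3 27 = count T' (iota 0 m) by rewrite F3 // !updE.
  have le_cnt : count T' (iota 0 m) <= m by rewrite -[m in leqRHS](size_iota 0) count_size.
  apply: wp_if => fl; last first.
    apply: wp_nil; split; first by lia.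
    exists T'; split=> // u; rewrite -T'u.
    by move: fl; rewrite r3_16; case: (flag _ _) => //; rewrite andbF.
  have {}fl : flag S (drop j W) by move: fl; rewrite r3_16; case: (flag _ _).
  go; rewrite ?g5 ?r3_18; try by lia.
  rewrite hT //; apply: wp_if; rewrite !updE /= => eT; go.
    split; first by lia.
    exists T'; split; rewrite ?updE //= => u; rewrite -T'u fl andbT.
    by case: eqP => // ->; case: (T' y) eT.
    by rewrite ?r3_27 ?g1; lia.
  split; first by lia.
  have nTy : ~~ T' y by case: (T' y) eT.
  exists (fun u => if u == y then true else T' u); split; rewrite ?updE //=.
  - by move=> u; rewrite -T'u fl andbT; case: eqP.
  - by rewrite ?g5 ?r3_18 ?g1; apply: (layout_setT true L' lty).
  rewrite ?r3_27 ?g1 addn1 -(count_add_mem (iota_uniq 0 m) _ nTy); last by rewrite mem_iota.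
  by apply: eq_count => u /=; case: eqP.
by move=> t r' h' [le_t H] _; split=> //; lia.
Qed.

End Specs4.

(** * Checking a candidate and counting in base [m] *)

Section Specs5.
Variables (w n m p : nat) (W : seq nat).
Hypothesis n_gt0 : 0 < n.
Hypothesis big : 8 * (n.+1 * n.+1) <= 2 ^ w.
Hypothesis le_mn : m <= n.
Hypothesis le_Wn : size W <= n.
Hypothesis W_lt : forall j y, j < size W -> nth 0 W j = y.+1 -> y < m.
Hypothesis le_p : p <= 2 * n * n.

Let big1 : 8 * n.+1 <= 2 ^ w. Proof. by apply: leq_trans big; lia. Qed.
Let bigp : p + n < 2 ^ w.
Proof. by apply: leq_trans big; clear -le_p n_gt0; nia. Qed.

Notation layout := (layout n m W).
Notation valid := (valid W p m).

Lemma check_ok r h D S T : consts n r -> r 6 = p -> r 7 = m -> r 8 = size W ->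
  layout h D S T -> size D = m -> all (ltn^~ m) D ->
  wp w check_code (fun t r' h' => t <= m * (25 * n + 40) + 20 /\
    (r' 28 = valid D m /\ exists S' T', layout h' D S' T')) r h.
Proof.
move=> Cr r6 r7 r8 L szD ltD; rewrite /check_code; go.
apply: (wp_weaken (clear_ok n_gt0 big le_mn le_Wn Cr r7 L)).
move=> t1 r1 h1 [le_t1 L1] F1; have Cr1 := consts_frame F1 isT Cr.
go; try by lia.
apply: wp_weaken.
  apply: (wp_while (I := fun c r' h' => exists k T', [/\ k <= m,
     c = (m - k) * (25 * n + 30) + 2,
     r' 24 = k, r' 28 = valid D k & [/\ T' =1 reached (mem (take k D)) W,
     layout h' D (mem (take k D)) T' & r' 27 = count T' (iota 0 m)]])
     (n := m * (25 * n + 30) + 2)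
     (Q := fun r' h' => r' 28 = valid D m /\ exists S' T', layout h' D S' T')); last first.
    exists 0, pred0; split; rewrite ?subn0 ?updE //; split.
    - by move=> u; rewrite take0 (eq_reached _ _ (S' := pred0)) // reached0.
    - by apply: (layout_ext L1) => i _ //; rewrite take0.
    - by rewrite count_pred0.
  move=> c r' h' [k [T' [lek -> r24 r28 [T'E L' r27]]]] F.
  have Cr' : consts n r' by apply: (consts_frame F) => //; do 3!apply: consts_upd => //.
  have r7' : r' 7 = m by rewrite F // !updE /= F1.
  have [f0 f1 f2 f3 [f4 f5 _ _ f30]] := Cr'.
  go; rewrite r7' r24; split=> [stop|cont].
    have ek : k = m by lia.
    by split; [lia | split; [rewrite r28 ek | exists (mem (take k D)), T']].
  have ltk : k < m by lia.
  have [hW hD hS hT] := L'.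
  set d := nth 0 D k.
  have ltd : d < m by have /all_nthP := ltD; apply; rewrite szD.
  go; rewrite ?f3 ?r24 ?hD ?f4 -/d ?f1; try by lia.
  rewrite hS //.
  have takeS : take k.+1 D = rcons (take k D) d by rewrite (take_nth 0) ?szD.
  apply: (wp_weaken (Q := fun t2 r2 h2 => [/\ t2 <= 3, h2 = upd h' (4 * n + d) 1 &
      r2 28 = valid D k && (d \notin take k D)])).
    apply: wp_if; rewrite !updE /= => ed; go; try by lia.
      by split=> //; case: (d \in _) ed; rewrite ?andbF.
    by split=> //; rewrite r28; case: (d \in _) ed; rewrite ?andbT.
  move=> t2 r2 h2 [le_t2 -> r2_28] F2.
  have Cr2 : consts n r2.
    by apply: (consts_frame F2) => //; do 5!apply: consts_upd => //.
  apply: wp_seq; apply: wp_weaken.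
    apply: (@scan_ok w n m W n_gt0 big le_mn le_Wn W_lt r2 _ D (mem (take k.+1 D)) T' Cr2).
    - by rewrite F2 // !updE /= F // !updE /= F1.
    - apply: (layout_ext (layout_setS n_gt0 big le_mn le_Wn true L' ltd)) => // i _ /=.
      by rewrite takeS mem_rcons inE; case: eqP.
    - by rewrite F2 // !updE /=.
  move=> t3 r3 h3 [le_t3 [T3 [T3E L3 r3_27]]] F3.
  have Cr3 := consts_frame F3 isT Cr2; have [g0 g1 _ _ _] := Cr3.
  have r3_6 : r3 6 = p by rewrite F3 // F2 // !updE /= F // !updE /= F1.
  have r3_24 : r3 24 = k by rewrite F3 // F2 // !updE /=.
  have r3_28 : r3 28 = valid D k && (d \notin take k D) by rewrite F3.
  go; rewrite ?r3_6 ?r3_24; first by lia.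
  (* Marks from earlier rounds do no harm, since [reached] is monotone in the set of closed
     pallets. *)
  have T3E' : T3 =1 reached (mem (take k.+1 D)) W.
    move=> u; rewrite T3E T'E; case: (boolP (reached (mem (take k.+1 D)) W u)); rewrite ?orbT //.
    rewrite orbF => nu; apply/negbTE; apply: contra nu; apply: reached_sub => x /=.
    by rewrite takeS mem_rcons inE => ->; rewrite orbT.
  apply: (wp_weaken (Q := fun t4 r4 h4 => [/\ t4 <= 3, h4 = h3 & r4 28 = valid D k.+1])).
    rewrite validS andbA -/d -(eq_count T3E').
    apply: wp_if; rewrite !updE /= r3_27 => ed; go; try by lia.
      by split=> //; rewrite leqNgt -subn_gt0 lt0n ed andbF.
    by split=> //; rewrite r3_28 -subn_eq0 ed andbT.
  move=> t4 r4 h4 [le_t4 -> r4_28] F4.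
  have r4_24 : r4 24 = k by rewrite F4 // !updE /=.
  have r4_1 : r4 1 = 1 by rewrite F4 // !updE /=.
  go; rewrite ?r4_24 ?r4_1; first by lia.
  exists ((m - k.+1) * (25 * n + 30) + 2); split.
    have le_t3' : t3 <= 25 * n + 5.
      by apply: leq_trans le_t3 _; rewrite leq_add2r leq_mul2l le_Wn.
    rewrite -(subnSK ltk) (mulSn (m - k.+1)); move: (_ * (25 * n + 30)) => X.
    clear -le_t2 le_t4 le_t3'; lia.
  exists k.+1, T3; split; rewrite ?updE //= ?r4_24 ?r4_1 ?addn1 //.
  by split=> //; rewrite F4 // !updE.
move=> t r' h' [le_t H] _; split=> //.
have -> : m * (25 * n + 40) = m * (25 * n + 30) + 10 * m.
  by rewrite [10 * m]mulnC -mulnDr -addnA.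
by move: (m * (25 * n + 30)) le_t => X; lia.
Qed.

(** The invariant expresses that the [k] lowest digits were [m - 1], so that a carry of weight
    [m ^ k] is pending. For [k = m] it says that the last candidate has been passed. *)
Lemma next_ok r h D S T : consts n r -> r 7 = m ->
  layout h D S T -> size D = m -> all (ltn^~ m) D ->
  wp w next_code (fun t r' h' => t <= 12 * m + 20 /\
    (r' 29 = 0 /\ (value m D).+1 = m ^ m \/
     r' 29 = r 29 /\ exists D', [/\ layout h' D' S T, size D' = m, all (ltn^~ m) D' &
       value m D' = (value m D).+1])) r h.
Proof.
move=> Cr r7 L szD ltD; rewrite /next_code; go; first by lia.
apply: wp_weaken.
  apply: (wp_while (I := fun c r' h' => exists k, [/\ k <= m, c = 12 * (m - k) + 12,
     r' 24 = k, layout h' (nseq k 0 ++ drop k D) S T &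
     (value m D).+1 = m ^ k * (value m (drop k D)).+1])
     (n := 12 * m + 12)
     (Q := fun r' h' => exists k, [/\ k <= m, r' 24 = k,
        layout h' (nseq k 0 ++ drop k D) S T,
        (value m D).+1 = m ^ k * (value m (drop k D)).+1 &
        k < m -> [/\ r' 26 = 3 * n + k, r' 18 = nth 0 D k & (nth 0 D k).+1 < m]])); last first.
    by exists 0; split; rewrite ?subn0 ?updE ?drop0 // mul1n.
  move=> c r' h' [k [lek -> r24 L' vE]] F.
  have Cr' : consts n r' by apply: (consts_frame F) => //; apply: consts_upd.
  have r7' : r' 7 = m by rewrite F // updE.
  have [f0 f1 f2 f3 [f4 f5 _ _ f30]] := Cr'.
  have [hW hD hS hT] := L'.
  go; rewrite ?f3 ?r24 ?r7' ?f1; first by lia.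
  (* For [k = m] the cell read lies behind the digits; its content is irrelevant, as register 25
     becomes 0 in either branch. *)
  have hk : k < m -> h' (3 * n + k) = nth 0 D k.
    by move=> ltk; rewrite hD // nth_cat size_nseq ltnn subnn nth_drop addn0.
  apply: wp_if; rewrite !updE /= => e19; go; first by lia.
    split=> // _; split; first by lia.
    exists k; split; rewrite ?updE //= => ltk; split; rewrite ?hk //.
    by move: e19; rewrite hk //; lia.
  split=> [e25|e25].
    split; first by lia.
    by exists k; split; rewrite ?updE //= => ltk; lia.
  have ltk : k < m by lia.
  have dk : nth 0 D k = m.-1.
    have : nth 0 D k < m by have /all_nthP := ltD; apply; rewrite szD.
    by move: e19; rewrite hk //; lia.
  have L2 : layout (upd h' (3 * n + k) 0) (nseq k.+1 0 ++ drop k.+1 D) S T.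
    apply: (layout_setD n_gt0 big le_mn le_Wn L' ltk) => i lti.
    rewrite !nth_cat !size_nseq !nth_nseq !nth_drop ltnS.
    by case: (ltngtP i k) => //= ltki; rewrite !subnKC // ltnW.
  go; rewrite ?f30 ?r24 ?f1; first by lia.
  exists (12 * (m - k.+1) + 12); split; first by lia.
  exists k.+1; split; rewrite ?updE /= ?f1 ?r24 ?addn1 //.
  rewrite vE (drop_nth 0) ?szD // -/(nth 0 D k) dk expnSr -mulnA /=; congr (_ * _).
  by rewrite mulnS -addSn prednK // (leq_ltn_trans _ ltk).
move=> t1 r1 h1 [le_t1 [k [lek r24 L1 vE Hk]]] F1.
have Cr1 : consts n r1 by apply: (consts_frame F1) => //; apply: consts_upd.
have [f0 f1 f2 f3 [f4 f5 _ _ f30]] := Cr1.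
have r1_7 : r1 7 = m by rewrite F1 // updE.
have r1_29 : r1 29 = r 29 by rewrite F1 // updE.
go; rewrite r1_7 r24; apply: wp_if; rewrite !updE /= => e25; last first.
  go; first by lia.
  split; first by lia.
  left; rewrite ?updE; split=> //; have ek : k = m by clear -e25 lek; lia.
  by rewrite vE ek [drop m D]drop_oversize ?szD ?muln1.
have ltk : k < m by lia.
have [r26 r18 ltd] := Hk ltk.
go; rewrite ?r18 ?f1; first by lia.
split; first by lia.
right; rewrite ?updE /=; split=> //; rewrite ?r26 addn1.
exists (nseq k 0 ++ (nth 0 D k).+1 :: drop k.+1 D); split.
- apply: (layout_setD n_gt0 big le_mn le_Wn L1 ltk) => i lti.
  rewrite !nth_cat !size_nseq !nth_nseq !nth_drop.
  case: (ltngtP i k) => //= ltki; last by rewrite ltki subnn.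
  by rewrite subnKC ?(ltnW ltki) // -(subnSK ltki) /= nth_drop subnKC.
- by rewrite size_cat size_nseq /= size_drop szD; lia.
- rewrite all_cat all_nseq /= ltd (leq_ltn_trans _ ltk) // orbT /=.
  by apply/allP => x /mem_drop xD; apply: (allP ltD).
by rewrite value_nseq vE (@drop_nth _ 0 k) ?szD.
Qed.

(** [K] pays for one check and one increment, and the credit is [K] for each value not yet refuted.
    The invariant is that all lists of smaller value are invalid, or that the answer is settled and
    register 29 is 0. *)
Lemma search_ok r h : consts n r -> r 6 = p -> r 7 = m -> r 8 = size W -> r 31 = 0 ->
  layout h (nseq m 0) pred0 pred0 ->
  wp w search_code (fun t r' h' => t <= m ^ m * (m * (25 * n + 52) + 50) + 5 /\
    (r' 31 <> 0 <-> exists D, [/\ size D = m, all (ltn^~ m) D & valid D m])) r h.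
Proof.
move=> Cr r6 r7 r8 r31 L; rewrite /search_code; go; first by lia.
set K := m * (25 * n + 52) + 50.
apply: wp_weaken.
  apply: (wp_while (I := fun c r' h' =>
     (exists D S T, [/\ c = (m ^ m - value m D) * K + 2, r' 29 = 1, r' 31 = 0,
        layout h' D S T & [/\ size D = m, all (ltn^~ m) D &
        forall D', size D' = m -> all (ltn^~ m) D' -> value m D' < value m D ->
          ~~ valid D' m]]) \/
     [/\ c = 2, r' 29 = 0 & (r' 31 <> 0 <->
        exists D, [/\ size D = m, all (ltn^~ m) D & valid D m])])
     (n := m ^ m * K + 2)
     (Q := fun r' h' => (r' 31 <> 0 <->
        exists D, [/\ size D = m, all (ltn^~ m) D & valid D m]))); last first.
    left; exists (nseq m 0), pred0, pred0.
    have v0 : value m (nseq m 0) = 0 by have := value_nseq m m [::]; rewrite cats0 muln0.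
    split; rewrite ?v0 ?subn0 ?updE //; split; rewrite ?size_nseq // all_nseq.
    by case: (m).
  move=> c r' h' H F; apply: wp_nil; split=> [r29|r29].
    by case: H => [[D [S [T [_]]]]|[-> _ H]]; rewrite ?r29.
  case: H => [[D [S [T [-> r29' r31' L' [szD ltD nD]]]]]|[_ /eqP]]; last by rewrite (negPf r29).
  have Cr' : consts n r' by apply: (consts_frame F) => //; apply: consts_upd.
  have r6' : r' 6 = p by rewrite F.
  have r7' : r' 7 = m by rewrite F.
  have r8' : r' 8 = size W by rewrite F.
  have ltv : value m D < m ^ m by rewrite -{3}szD; apply: value_lt.
  go; apply: (wp_weaken (check_ok Cr' r6' r7' r8' L' szD ltD)).
  move=> t1 r1 h1 [le_t1 [r1_28 [S' [T' L1]]]] F1.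
  have KE : K = m * (25 * n + 40) + 12 * m + 50.
    by rewrite /K [12 * m]mulnC -mulnDr -addnA.
  have r1_31 : r1 31 = 0 by rewrite F1.
  apply: wp_if; rewrite r1_28 => ev.
    go; try by lia.
    exists 2; split.
      rewrite -(subnSK ltv) (mulSn (m ^ m - _)) {1}KE.
      by move: (_ * K) (m * (25 * n + 40)) le_t1 => X Y le_t1; clear -le_t1; lia.
    right; split; rewrite ?updE //=; split=> // _; exists D; split=> //.
    by case: (valid D m) ev.
  have nv : ~~ valid D m by case: (valid D m) ev.
  have Cr1 := consts_frame F1 isT Cr'.
  apply: (wp_weaken (next_ok Cr1 _ L1 szD ltD)); first by rewrite F1.
  have nD' D' : size D' = m -> all (ltn^~ m) D' -> value m D' < (value m D).+1 ->
      ~~ valid D' m.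
    move=> szD' ltD'; rewrite ltnS leq_eqVlt => /orP[/eqP eD|]; last exact: nD.
    by rewrite (value_inj ltD' ltD _ eD) ?szD' ?szD.
  move=> t2 r2 h2 [le_t2 H2] F2.
  have r2_31 : r2 31 = 0 by rewrite F2.
  have cost' v : v < m ^ m -> (m ^ m - v.+1) * K + 2 + (0 + (t1 + t2.+1)).+2 <= (m ^ m - v) * K + 2.
    move=> lt_v; rewrite -(subnSK lt_v) (mulSn (m ^ m - _)) {2}KE.
    by move: (_ * K) (m * (25 * n + 40)) le_t1 => X Y le_t1; clear -le_t1 le_t2; lia.
  case: H2 => [[r2_29 vE]|[r2_29 [D' [L2 szD' ltD' vE]]]].
    exists 2; split; first by have := cost' _ ltv; move: (_ * K) (_ * K) => X Y; lia.
    right; split=> //; rewrite r2_31; split=> // -[D' [szD' ltD' vD']].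
    have := nD' _ szD' ltD'; rewrite vD' vE => /(_ _)/negP; case=> //.
    by rewrite -{3}szD'; apply: value_lt.
  exists ((m ^ m - value m D') * K + 2); split; first by rewrite vE; apply: cost'.
  left; exists D', S', T'; split=> //; last by split=> //; rewrite vE.
  by rewrite r2_29 F1.
by move=> t r' h' [le_t H] _; split=> //; move: (_ * K) le_t => X; lia.
Qed.

End Specs5.

(** * Correctness and running time *)

Lemma uniq_nth_notin_take (s : seq nat) :
  (forall i, i < size s -> nth 0 s i \notin take i s) <-> uniq s.
Proof.
split=> [H|us i lti]; last first.
  have : uniq (take i.+1 s) by rewrite take_uniq.
  by rewrite (take_nth 0) // rcons_uniq => /andP[].
apply/(uniqP 0) => i j; rewrite !inE.
wlog ltij : i j / i < j => [W lti ltj e|lti ltj e].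
  by case: (ltngtP i j) => // ltij; [apply: W | apply/esym; apply: W].
case/negP: (H j ltj); rewrite -e -(nth_take 0 ltij) mem_nth // size_take.
by case: ifP.
Qed.

Lemma cut_map (S : pred nat) f s : cut S (map f s) = cut (preim f S) s.
Proof. by elim: s => //= x s ->; rewrite has_map. Qed.

(** The final 0 separates a sequence from what follows; within the sequence, the reached pallets are
    those in front of the cut. *)
Lemma reached_block S s W u :
  flag S (rcons (map succn s) 0 ++ W) = has S s /\
  reached S (rcons (map succn s) 0 ++ W) u =
    (u \in take (cut S s) s) || reached S W u.
Proof.
elim: s => [|x s [IHf IHr]] /=; first by [].
rewrite IHf IHr eqSS; split=> //; case: ifP => /= [_|/negbT].
  by rewrite inE [u == x]eq_sym orbA.
rewrite negb_or => /andP[_ nS].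
suff -> : cut S s = 0 by rewrite take0.
by case: (s) nS => //= y s' /negPf ->.
Qed.

(** * From the coded input back to the instance *)

Section Encoding.
Variable I : instance.

Definition tokens : seq (option nat) :=
  flatten [seq rcons [seq Some (plt b) | b <- q] None | q <- Q I].

Lemma encodeE : encode I = bits (p I) ++ 3 :: flatten (map enc tokens).
Proof.
rewrite /encode /tokens; congr (_ ++ _ :: _); elim: (Q I) => //= q qs ->.
rewrite map_cat flatten_cat map_rcons flatten_rcons; rewrite -map_comp.
exact: erefl.
Qed.

Let P := symbol_table tokens.
Let m := num_pallets I.

Lemma mem_tokens t : (t \in P) = (t \in pallets I).
Proof.
rewrite mem_symbol_table mem_undup; apply/flattenP/mapP => [[s /mapP[q qQ ->]]|[b]].
  rewrite mem_rcons inE /= => /mapP[b bq [->]]; exists b => //.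
  by apply/flattenP; exists q.
case/flattenP=> q qQ bq ->; exists (rcons [seq Some (plt b) | b <- q] None).
  by apply/mapP; exists q.
by rewrite mem_rcons inE /=; apply/mapP; exists b.
Qed.

Lemma perm_pallets : perm_eq (pallets I) P.
Proof.
by apply: uniq_perm; rewrite ?undup_uniq ?symbol_table_uniq // => t; rewrite mem_tokens.
Qed.

Lemma size_table : size P = m.
Proof. by rewrite /m /num_pallets (perm_size perm_pallets). Qed.

Definition word := map (code P) tokens.

Lemma wordE : word =
  flatten [seq rcons (map succn [seq index (plt b) P | b <- q]) 0 | q <- Q I].
Proof.
rewrite /word /tokens map_flatten -map_comp; congr flatten; apply: eq_map => q /=.
by rewrite map_rcons -!map_comp.
Qed.

Lemma word_lt j y : j < size word -> nth 0 word j = y.+1 -> y < m.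
Proof.
rewrite size_map => ltj; rewrite (nth_map None) //.
case E: (nth None tokens j) => [v|] //= [<-].
by rewrite -size_table index_mem mem_symbol_table -E mem_nth.
Qed.

(** Both sides decompose into the sequences; on each of them, passing to indices does not move the
    cut, as [index] is injective on [P]. *)
Lemma reachedE (S : pred nat) (S' : pred nat) t :
  t \in P -> {in P, forall x, S (index x P) = S' x} ->
  reached S word (index t P) = touched I S' t.
Proof.
move=> tP SS'; rewrite wordE.
have -> : touched I S' t =
    has (fun q => t \in take (cut S' (map (@plt I) q)) (map (@plt I) q)) (Q I).
  apply/existsP/hasP => [[j]|[q qQ tq]].
    by rewrite ffunE => tj; exists (bins_of j) => //; apply: mem_nth.
  have lt_q : index q (Q I) < nb_seqs I by rewrite index_mem.
  exists (Ordinal lt_q); rewrite ffunE /symbols.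
  by rewrite (_ : bins_of _ = q) // /bins_of nth_index.
(* The induction runs over the sequences while [P] keeps referring to the whole instance, hence the
   inclusion. *)
have: {subset Q I <= Q I} by [].
elim: {1 3 4}(Q I) => [|q qs IH] sub; first by [].
rewrite [flatten _]/= (reached_block _ _ _ _).2 IH; last first.
  by move=> q' q's; apply: sub; rewrite inE q's orbT.
have -> : [seq index (plt b) P | b <- q] = map (index^~ P) (map (@plt I) q).
  by rewrite -map_comp.
congr (_ || _); rewrite cut_map -map_take.
have qP x : x \in map (@plt I) q -> x \in P.
  move=> /mapP[b bq ->]; rewrite mem_tokens mem_undup; apply/mapP; exists b => //.
  by apply/flattenP; exists q => //; apply: sub; rewrite mem_head.
have -> : cut (preim (index^~ P) S) (map (@plt I) q) = cut S' (map (@plt I) q).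
  by apply/eqP; rewrite eqn_leq !cut_sub // => x /qP xP; rewrite /= SS'.
apply/mapP/idP => [[x xt]|tt]; last by exists t.
have xP : x \in P := qP x (mem_take xt).
by move=> e; rewrite -(nth_index 0 tP) e nth_index.
Qed.

(** The map sending [k] to [nth 0 P k] is a bijection from the indices below [m] to the pallets. *)
Lemma count_reached D i : all (ltn^~ m) D ->
  count (touched I (mem (take i (map (nth 0 P) D)))) (pallets I) =
  count (reached (mem (take i D)) word) (iota 0 m).
Proof.
move=> ltD; rewrite (permP perm_pallets) -{2}(mkseq_nth 0 P) /mkseq size_table count_map.
apply: eq_in_count => k; rewrite mem_iota => /= ltk.
have ltkP : k < size P by rewrite size_table.
rewrite -{2}(index_uniq 0 ltkP (symbol_table_uniq tokens)).
apply/esym/reachedE => [|x xP]; first by rewrite mem_nth.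
rewrite /= -map_take; apply/idP/mapP => [xD|[k' k'D ->]].
  by exists (index x P); rewrite ?nth_index.
rewrite index_uniq ?symbol_table_uniq // size_table.
exact: (allP ltD _ (mem_take k'D)).
Qed.

(** The counts never exceed [m <= n], so comparing them with [p' + i] or with [p I + i] gives the
    same result although [p'] is exact only up to [n]. *)
Lemma valid_good_order p' n : m <= n -> minn p' n.+1 = minn (p I) n.+1 ->
  (exists D, [/\ size D = m, all (ltn^~ m) D & valid word p' m D m]) <->
  (exists E, good_order I E).
Proof.
move=> le_mn min_p.
have leE c i : c <= m -> (c <= p' + i) = (c <= p I + i) by lia.
have le_cnt S : count S (iota 0 m) <= m by rewrite -[m in leqRHS](size_iota 0) count_size.
have validP D : size D = m -> all (ltn^~ m) D -> valid word p' m D m <->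
    uniq D /\ (forall i, i < m -> count (touched I
      (mem (take i.+1 (map (nth 0 P) D)))) (pallets I) <= p I + i).
  move=> szD ltD; rewrite -uniq_nth_notin_take szD; split=> [/allP H|[H1 H2]].
    split=> i lti; have := H i; rewrite mem_iota add0n lti => /(_ isT)/andP[] //.
    by rewrite count_reached // leE.
  apply/allP => i; rewrite mem_iota add0n => /= lti; rewrite H1 //= leE //.
  by rewrite -count_reached // H2.
have uP := symbol_table_uniq tokens.
split=> [[D [szD ltD /(validP _ szD ltD)[uD H]]]|[E [uE eE H]]].
  have uE : uniq (map (nth 0 P) D).
    rewrite map_inj_in_uniq // => x y xD yD /eqP.
    have xm : x < m := allP ltD x xD; have ym : y < m := allP ltD y yD.
    by rewrite nth_uniq ?size_table // => /eqP.
  exists (map (nth 0 P) D); split=> //; last by move=> i; rewrite size_map szD; apply: H.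
  (* [m] distinct pallets are all the pallets. *)
  have [] // := uniq_min_size (s2 := pallets I) uE; last by rewrite size_map szD.
  by move=> x /mapP[k kD ->]; rewrite -mem_tokens mem_nth // size_table; apply: (allP ltD).
have szE : size E = m.
  by apply/eqP; rewrite -(perm_size (s1 := pallets I)) // uniq_perm ?undup_uniq.
have EP x : x \in E -> x \in P by rewrite eE mem_tokens.
have ltD : all (ltn^~ m) (map (index^~ P) E).
  by apply/allP => k /mapP[x /EP xP ->]; rewrite /= -size_table index_mem.
have DE : map (nth 0 P) (map (index^~ P) E) = E.
  by rewrite -map_comp map_id_in // => x /EP xP /=; rewrite nth_index.
exists (map (index^~ P) E); split; rewrite ?size_map //.
apply/validP; rewrite ?size_map // DE; split; last by rewrite -szE.
rewrite map_inj_in_uniq // => x y /EP xP /EP yP e.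
by rewrite -(nth_index 0 xP) e nth_index.
Qed.

End Encoding.

Theorem theorem16 :
  exists (P : program) (C d : nat),
    solves_fifo_stack_up_in_time P
      (fun I : instance =>
         let m := num_pallets I in
         C * inst_size I * (m ^ 4 + 2 * m ^ 2 + 1) ^ (d * m ^ 4)).
Proof.
(* [200] covers the coefficients collected in the estimate of [T], [2] yields [m.+1 <= 2 * m ^ 4]
   for [m > 0], and [4] yields [n.+1 ^ 4 <= 2 ^ w]. *)
exists (compile 0 main_code), 200, 2, 4; split=> // I; cbv beta zeta.
set n := inst_size I; set m := num_pallets I; set w := 4 * bit_length n.
set L := size (bits (p I)).
have nE : n = L.+1 + size (flatten (map enc (tokens I))).
  by rewrite /n /inst_size encodeE size_cat /= addnS.
have lt_L : L < n by rewrite nE leq_addr.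
have n_gt1 : 1 < n by rewrite nE.
have n_gt0 : 0 < n := ltnW n_gt1.
(* As [n] is at least 2, one factor [n.+1 ^ 2 >= 9] absorbs the 8. *)
have big : 8 * (n.+1 * n.+1) <= 2 ^ w.
  rewrite /w [4 * _]mulnC expnM.
  have lt_n : n < 2 ^ bit_length n by apply: trunc_log_ltn.
  apply: leq_trans (_ : n.+1 ^ 4 <= _); last by rewrite leq_exp2r.
  by rewrite (expnD _ 2 2) leq_mul // (leq_trans (_ : 8 <= 3 * 3)) // leq_mul.
have szW : size (word I) <= n.
  by rewrite size_map nE (leq_trans (size_flatten_enc _)) // leq_addl.
have le_mn : m <= n.
  rewrite /m -size_table (leq_trans (size_symbol_table _)) //.
  by move: szW; rewrite size_map.
pose T := 8 + (16 * L.+1 + (1 + (size (flatten (map enc (tokens I))) * (24 * m + 40) + 2 +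
   (m ^ m * (m * (25 * n + 52) + 50) + 5 + 1)))).
have le_T : T <= 200 * n * (m ^ 4 + 2 * m ^ 2 + 1) ^ (2 * m ^ 4).
  have leM : m ^ m * m.+1 <= (m ^ 4 + 2 * m ^ 2 + 1) ^ (2 * m ^ 4).
    (* For [m = 0] both sides are 1. *)
    have [->|m_gt0] := posnP m; first by [].
    have le_m2 : m <= m ^ 2 by rewrite -{1}(expn1 m) leq_pexp2l.
    have le_m4 : m <= m ^ 4 by rewrite -{1}(expn1 m) leq_pexp2l.
    set B := m ^ 4 + _ + 1.
    have le_B : m.+1 <= B by rewrite /B; lia.
    apply: leq_trans (_ : B ^ m.+1 <= _).
      by rewrite expnSr leq_mul // leq_exp2r // ltnW.
    by rewrite leq_pexp2l; rewrite /B; lia.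
  rewrite -mulnA; apply: leq_trans (leq_mul (leqnn _) (leq_mul (leqnn _) leM)).
  have M_gt0 : 0 < m ^ m by rewrite expn_gt0; case: (m).
  rewrite /T; have := nE; move: (size _) => s ns; move: (m ^ m) M_gt0 => M M_gt0.
  have h1 : s * (24 * m + 40) <= n * (24 * m + 40) by rewrite leq_mul2r ns leq_addl orbT.
  have h2 : n * (24 * m + 40) <= n * (M * (24 * m + 40)).
    by rewrite leq_mul2l leq_pmull ?orbT.
  have h3 : m * (25 * n + 52) + 50 <= n * (77 * m + 50).
    by have := leq_pmull m n_gt0; move: n_gt0; move: (m) (n) => a b; clear; lia.
  have h4 : M * (m * (25 * n + 52) + 50) <= n * (M * (77 * m + 50)).
    by rewrite mulnCA leq_mul2l h3 orbT.
  have h5 : 50 * n <= n * (M * 50) by rewrite mulnC leq_mul2l leq_pmull ?orbT.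
  have h6 : 8 + 16 * L.+1 + 9 <= 50 * n by lia.
  have -> : 200 * (n * (M * m.+1)) = n * (M * (24 * m + 40)) + n * (M * (77 * m + 50)) +
      n * (M * 50) + n * (M * (99 * m + 60)) by lia.
  by lia.
have main_ok : wp w main_code (fun t r' h' => t <= T /\
    (r' 0 <> 0 <-> fifo_stack_up I))
    (upd (fun=> 0) 0 n) (fun a => nth 0 (encode I) a).
  rewrite /main_code; apply: wp_seq.
  apply: (wp_weaken (init_ok n_gt0 big _ _ _)) => // t1 r1 h1 [le_t1 Cr1 -> r1_10] F1.
  apply: wp_seq.
  apply: (wp_weaken (@parse_ok w n n_gt0 big (p I) r1 _ (flatten (map enc (tokens I))) _ _ Cr1 _ _ r1_10));
    rewrite -?encodeE ?F1 //.
  move=> t2 r2 h2 [le_t2 [-> r2_9 le_p min_p]] F2.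
  have Cr2 := consts_frame F2 isT Cr1; have [e0 e1 _ _ _] := Cr2.
  go; rewrite ?r2_9 ?e1 -/L; first by apply: leq_trans big; clear -lt_L; nia.
  set r3 := upd r2 9 (L + 1).
  have Cr3 : consts n r3 by apply: consts_upd.
  apply: (wp_weaken (@tokens_ok w n n_gt0 big r3 _ (tokens I) L.+1 Cr3 _ _ _ _ nE _ _)).
  - by rewrite /r3 updE /= F2 // F1.
  - by rewrite /r3 updE /= F2 // F1.
  - by rewrite /r3 updE /= addn1.
  - by [].
  - by move=> i lti; rewrite encodeE addSnnS nth_cat ltnNge leq_addr /= addKn.
  - by move=> a lea; rewrite nth_default.
  rewrite -/(tokens I) size_table -/m.
  move=> t4 r4 h4 [le_t4 [r4_7 r4_8 hW h0]] F4.
  have Cr4 := consts_frame F4 isT Cr3.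
  apply: wp_seq.
  apply: (wp_weaken (@search_ok w n m (r2 6) (word I) n_gt0 big le_mn szW
    (@word_lt I) le_p r4 h4 Cr4 _ r4_7 _ _ _)).
  - by rewrite F4 // /r3 updE.
  - by rewrite size_map.
  - by rewrite F4 // /r3 updE /= F2 // F1.
  (* The untouched zero cells represent the candidate with all digits 0 and two empty sets. *)
  - split=> [j|k ltk|k ltk|k ltk]; last 3 first.
    + by rewrite nth_nseq ltk h0 // leq_addr.
    + by rewrite h0 // (leq_trans _ (leq_addr _ _)) // leq_mul2r orbT.
    + by rewrite h0 // (leq_trans _ (leq_addr _ _)) // leq_mul2r orbT.
    by rewrite size_map => ltj; rewrite hW // (nth_map None).
  move=> t5 r5 h5 [le_t5 acc] F5.
  have [_ _ _ _ [_ _ _ _ e30]] := consts_frame F5 isT Cr4.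
  go; rewrite e30 subn0; split.
    by rewrite /T !leq_add // ; lia.
  rewrite acc (valid_good_order le_mn min_p).
  by apply: iff_sym; apply: fifo_stack_upP.
have [|t [r' [h' [[_ acc] E]]]] :=
  wp_accepts (T := 200 * n * (m ^ 4 + 2 * m ^ 2 + 1) ^ (2 * m ^ 4)) main_ok.
  by move=> t r' h' [/leq_trans/(_ le_T)].
have {}E : iter (200 * n * (m ^ 4 + 2 * m ^ 2 + 1) ^ (2 * m ^ 4))
  (step w (compile 0 main_code)) (start (encode I)) = State (csize main_code) r' h' := E.
rewrite /solves_within; cbv zeta; rewrite E /halted size_compile leqnn; split=> //.
by rewrite /accepts [reg _]/= -acc; split; [move/eqP | move=> ?; apply/eqP].
Qed.
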